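(* Let $\alpha\in(\tfrac12,1)$, $s=p^{1-\alpha}$, and $A=\sqrt{2r\log p/n}$ with $r>\alpha$. Assume either $\mathbf X\in\mathrm{SubG}(\sigma^2)$ with $n/p^{3/2}\to\infty$, or $\mathbf X\in\mathcal O_n(p)$ with $n\ge p$. For $\tau>0$ let $T(\tau)=\sum_{j=1}^p\mathbf 1(|z_j|>\tau)$ and for $t\in\mathbb R$ let $\xi(t,\tau)=\mathbf 1(T(\tau)>t)$. Then $$\liminf_{p\to\infty}\frac{\log\inf_{t}\mathrm{Risk}\big(\xi(t,\sqrt{2\log p}),s,A\big)}{s\log p}>-\frac{(r-\alpha)^2}{4r}.$$
   Context: Setting: for each $p$ one observes $(\mathbf y,\mathbf X)$ with $\mathbf y=\mathbf X\boldsymbol\beta+\boldsymbol\varepsilon$, where $\boldsymbol\varepsilon\sim\mathcal N(0,I_n)$, $\mathbf X$ is an $n\times p$ real matrix independent of $\boldsymbol\varepsilon$, $\boldsymbol\beta\in\mathbb R^p$ is unknown, and $n=n(p)\to\infty$ as $p\to\infty$. Design classes: $\mathbf X\in\mathrm{SubG}(\sigma^2)$ means the rows of $\mathbf X$ are i.i.d. centered isotropic ($\mathbb E[xx^T]=I_p$) sub-Gaussian random vectors with sub-Gaussian parameter $\sigma^2$ (for every unit $u$ and $t\in\mathbb R$, $\log\mathbb E e^{t\langle u,x\rangle}\le\sigma^2t^2/2$), and $\mathbf X^T\mathbf X$ is almost surely positive definite; $\mathbf X\in\mathcal O_n(p)$ means $\mathbf X^T\mathbf X=nI_p$. For an integer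 $s$ and $A>0$, $\Xi(s,A)=\{\boldsymbol\beta\in\mathbb R^p:|\mathrm{supp}(\boldsymbol\beta)|=s,\ |\beta_i|\ge A\text{ for }i\in\mathrm{supp}(\boldsymbol\beta)\}$. A test $T$ is a measurable $[0,1]$-valued function of $(\mathbf y,\mathbf X)$; $\mathbb E_{\boldsymbol\beta}$ denotes expectation over $(\mathbf y,\mathbf X)$ under parameter $\boldsymbol\beta$, $\mathbb E_0$ under $\boldsymbol\beta=0$. $\mathrm{Risk}(T,s,A)=\mathbb E_0[T]+\sup_{\boldsymbol\beta\in\Xi(s,A)}\mathbb E_{\boldsymbol\beta}[1-T]$. The vector $\mathbf z=(z_1,\dots,z_p)=(\mathbf X^T\mathbf X)^{-1/2}\mathbf X^T\mathbf y$, where $(\mathbf X^T\mathbf X)^{-1/2}=OD^{-1/2}O^T$ for a spectral decomposition $\mathbf X^T\mathbf X=ODO^T$. *)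

(* Defs.v *)
From HB Require Import structures.
From mathcomp Require Import all_boot all_order all_algebra.
From mathcomp Require Import all_classical all_reals all_analysis.
Set Implicit Arguments. Unset Strict Implicit. Unset Printing Implicit Defensive.
Import Order.TTheory GRing.Theory Num.Theory.
Local Open Scope classical_set_scope.
Local Open Scope ring_scope.

Section Defs.
Variable R : realType.

Definition posdefmx p (M : 'M[R]_p) : Prop :=
  forall v : 'cV[R]_p, v != 0 -> 0 < (v^T *m M *m v) 0 0.

Definition spectral_dec p (M : 'M[R]_p) (Od : 'M[R]_p * 'rV[R]_p) : Prop :=
  Od.1^T *m Od.1 = 1%:M /\ M = Od.1 *m diag_mx Od.2 *m Od.1^T.

Definition invsqrtmx p (M : 'M[R]_p) : 'M[R]_p :=
  let Od := xget (0, 0) (spectral_dec M) in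
  Od.1 *m diag_mx (map_mx (fun x => (Num.sqrt x)^-1) Od.2) *m Od.1^T.

Definition zstat n p (y : 'cV[R]_n) (X : 'M[R]_(n, p)) : 'cV[R]_p :=
  invsqrtmx (X^T *m X) *m X^T *m y.

Definition Tstat n p (tau : R) (y : 'cV[R]_n) (X : 'M[R]_(n, p)) : nat :=
  #|[set j : 'I_p | tau < `|zstat y X j 0|]|.

Definition xi_test n p (t tau : R) (y : 'cV[R]_n) (X : 'M[R]_(n, p)) : R :=
  if t < (Tstat tau y X)%:R then 1 else 0.

Definition Xi p (s : nat) (A : R) : set 'cV[R]_p :=
  [set b | #|[set i : 'I_p | b i 0 != 0]| = s /\
           forall i : 'I_p, b i 0 != 0 -> A <= `|b i 0|].

Definition Ebeta d (Om : measurableType d) (P : probability Om R) n p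
  (X : Om -> 'M[R]_(n, p)) (eps : Om -> 'cV[R]_n) (beta : 'cV[R]_p)
  (f : 'cV[R]_n -> 'M[R]_(n, p) -> R) : \bar R :=
  (\int[P]_w (f (X w *m beta + eps w) (X w))%:E)%E.

Definition Risk d (Om : measurableType d) (P : probability Om R) n p
  (X : Om -> 'M[R]_(n, p)) (eps : Om -> 'cV[R]_n)
  (T : 'cV[R]_n -> 'M[R]_(n, p) -> R) (s : nat) (A : R) : \bar R :=
  (Ebeta P X eps 0 T +
   ereal_sup [set Ebeta P X eps b (fun y X => (1 - T y X)%R) | b in @Xi p s A])%E.

Definition eln (x : \bar R) : \bar R :=
  match x with
  | EFin r => if (r <= 0)%R then -oo%E else (ln r)%:E
  | +oo%E => +oo%E
  | -oo%E => -oo%E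
  end.

Definition std_gauss_vec d (Om : measurableType d) (P : probability Om R) n
  (eps : Om -> 'cV[R]_n) : Prop :=
  (forall k, measurable_fun setT (fun w => eps w k ord0)) /\
  forall B : 'I_n -> set R, (forall k, measurable (B k)) ->
    P [set w | forall k, B k (eps w k ord0)] = (\prod_(k < n) normal_prob 0 1 (B k))%E.

Definition indep_design_noise d (Om : measurableType d) (P : probability Om R) n p
  (X : Om -> 'M[R]_(n, p)) (eps : Om -> 'cV[R]_n) : Prop :=
  forall (A : 'I_n -> 'I_p -> set R) (B : 'I_n -> set R),
    (forall i j, measurable (A i j)) -> (forall k, measurable (B k)) ->
    P [set w | (forall i j, A i j (X w i j)) /\ (forall k, B k (eps w k ord0))] =
    (P [set w | forall i j, A i j (X w i j)] * P [set w | forall k, B k (eps w k ord0)])%E.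

Definition SubG d (Om : measurableType d) (P : probability Om R) n p
  (sigma2 : R) (X : Om -> 'M[R]_(n, p)) : Prop :=
  (forall i j, measurable_fun setT (fun w => X w i j)) /\
      (forall A : 'I_n -> 'I_p -> set R, (forall i j, measurable (A i j)) ->
         P [set w | forall i j, A i j (X w i j)] =
         (\prod_(i < n) P [set w | forall j, A i j (X w i j)])%E) /\
      (forall (B : 'I_p -> set R) (i i' : 'I_n), (forall j, measurable (B j)) ->
         P [set w | forall j, B j (X w i j)] = P [set w | forall j, B j (X w i' j)]) /\
      (forall i j, (\int[P]_w (X w i j)%:E = 0)%E) /\
      (forall i j k, (\int[P]_w (X w i j * X w i k)%:E = ((j == k)%:R)%:E)%E) /\
      (forall i (u : 'cV[R]_p) (t : R), \sum_j u j ord0 ^+ 2 = 1 ->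
           (\int[P]_w (expR (t * \sum_j u j ord0 * X w i j))%:E
             <= (expR (sigma2 * t ^+ 2 / 2))%:E)%E) /\
        {ae P, forall w, posdefmx ((X w)^T *m X w)}.

Definition Orthdesign d (Om : measurableType d) n p (X : Om -> 'M[R]_(n, p)) : Prop :=
  (forall i j, measurable_fun setT (fun w => X w i j)) /\
  forall w, (X w)^T *m X w = (n%:R)%:M.

End Defs.

(* Main.v *)
Require Import Defs.
From HB Require Import structures.
From mathcomp Require Import all_boot all_order all_algebra.
From mathcomp Require Import all_classical all_reals all_analysis.
From mathcomp Require Import measurable_realfun complex ring lra.
Import Order.TTheory GRing.Theory Num.Theory.
Import numFieldNormedType.Exports.
Local Open Scope classical_set_scope.
Local Open Scope ring_scope.

(* Given the design [X], the statistic is [z = (X^T X)^(1/2) beta + W eps] with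
   [W = (X^T X)^(-1/2) X^T]; since [W W^T = 1], the vector [W eps] is standard Gaussian and
   independent of [X]. The mean is within Euclidean distance 1 of [sqrt n * beta] as soon as
   [|X^T X beta - n beta|^2 <= n], which always holds for an orthogonal design and, by a
   second moment computation, holds with probability at least 1/2 for a sub-Gaussian one
   because [n / p^(3/2)] tends to infinity and [s <= p^(1/2)].

   Write [v = max (sqrt r) 1] and let [k] be about [kappa * s]. If [t < k], the type I error
   is at least the probability that exactly [k] null coordinates exceed [sqrt (2 log p)],
   which is [exp (- kappa (1 - alpha) s log p (1 + o(1)))]. If [t >= k], the type II error is
   at least the probability that at least [s - k] of the [s] signals stay below the threshold
   and no null coordinate exceeds it, which is
   [exp (- (1 - kappa) (v - 1)^2 s log p (1 + o(1)))]. A suitable [kappa] in (0, 1) makes both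
   exponents strictly smaller than [(r - alpha)^2 / (4 r)]. *)

(** * Rotation invariance of Gaussian vectors *)

Section gauss2.
Context {R : realType}.
Notation mu := (@lebesgue_measure R).
Notation gam := (@normal_prob R 0 1).
Notation rT := (measurableTypeR R).

(** The value [(r - alpha)^2 / (4 r)] is a balance. With a threshold [u * sqrt (2 log p)], [s]
    exceedances among the nulls cost [u^2 - alpha] and hiding [s] signals costs [(sqrt r - u)^2], in
    units of [s log p]; both equal [(r - alpha)^2 / (4 r)] at [u = (r + alpha) / (2 sqrt r)]. Here
    [u = 1] is imposed. If the balancing [u] is not 1, one of the two costs is already too small and
    [kappa] is taken close to an end of (0, 1). If it is 1, both costs are equal to the balance, and
    the strict gain comes from splitting the work: [kappa * s] exceedances or [(1 - kappa) * s]
    hidden signals suffice. The maximum in [v] covers [r < 1], where the signals lie below the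
    threshold and hiding them costs nothing at this scale. The main obstacle is that [W] depends on
    the random design, so a fixed rotation is not enough. No conditional distribution is used: joint
    laws are identified with product measures, and rotation invariance is applied in each
    section. *)

Lemma lebesgue_measure_translate (c : R) (A : set R) : measurable A ->
  mu ((fun x => x + c) @^-1` A) = mu A.
Proof.
move=> mA.
have mf : measurable_fun setT (fun x : measurableTypeR R => (x + c) : measurableTypeR R).
  by apply: measurable_funD => //; exact: measurable_id.
pose isf := isMeasurableFun.Build _ _ _ _ _ mf.
pose F : {mfun measurableTypeR R >-> measurableTypeR R} := HB.pack (fun x : measurableTypeR R => (x + c) : measurableTypeR R) isf.
have := @lebesgue_measure_unique R (pushforward mu F) _ A mA.
move=> -> // X [[a b] _ <-] /=.
rewrite lebesgue_measure_itv /= /pushforward.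
have -> : (fun x => x + c) @^-1` `]a, b] = `](a - c), (b - c)]%classic.
  by apply/seteqP; split => x /=; rewrite !in_itv /= ltrBlDr lerBrDr.
rewrite lebesgue_measure_itv /= !lte_fin ltrD2r.
case: ifP => // _; by rewrite -!EFinD; congr EFin; ring.
Qed.

Lemma ge0_integral_translate (c : R) (f : R -> \bar R) :
  measurable_fun setT f -> (forall x, 0 <= f x)%E ->
  (\int[mu]_x f (x + c)%R = \int[mu]_x f x)%E.
Proof.
move=> mf f0.
have mF : measurable_fun setT (fun x : measurableTypeR R => (x + c) : measurableTypeR R).
  by apply: measurable_funD => //; exact: measurable_id.
have /= := ge0_integral_pushforward mF mu measurableT mf (fun y _ => f0 y).
rewrite preimage_setT => <-.
apply: eq_measure_integral => A mA _.
exact: (lebesgue_measure_translate c A mA).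
Qed.

(** The Radon-Nikodym derivative of [gam] is almost everywhere [normal_pdf 0 1], because both have
    the same integral over every measurable set. *)
Lemma ge0_integral_normal (f : R -> \bar R) :
  measurable_fun setT f -> (forall x, 0 <= f x)%E ->
  (\int[gam]_x f x = \int[mu]_x (f x * (normal_pdf 0 1 x)%:E))%E.
Proof.
move=> mf f0.
have dom : gam `<< mu by exact: normal_prob_dominates.
rewrite -(Radon_Nikodym_SigmaFinite.change_of_variables dom f0 measurableT mf).
have mpdf : measurable_fun setT (fun x : R => (normal_pdf 0 1 x)%:E).
  by apply/measurable_EFinP; exact: measurable_normal_pdf.
have mrn := measurable_int _ (Radon_Nikodym_SigmaFinite.f_integrable dom).
apply: ae_eq_integral => //; [exact: emeasurable_funM|exact: emeasurable_funM|].
have := integral_ae_eq measurableT (Radon_Nikodym_SigmaFinite.f_integrable dom) mpdf.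
move=> /(_ _)/[dup] _ H.
have {}H : ae_eq mu setT (Radon_Nikodym_SigmaFinite.f gam mu) (fun x : R => (normal_pdf 0 1 x)%:E).
  by apply: H => E _ mE; rewrite -(Radon_Nikodym_SigmaFinite.f_integral dom mE).
by apply: filterS H => x /= /(_ I) ->.
Qed.


Lemma ge0_integral_shear1 (t : R) (f : rT * rT -> \bar R) :
  measurable_fun setT f -> (forall z, 0 <= f z)%E ->
  (\int[mu]_x \int[mu]_y f (x + t * y, y)%R = \int[mu]_x \int[mu]_y f (x, y))%E.
Proof.
move=> mf f0.
have mg : measurable_fun setT (fun z : rT * rT =>
    f ((z.1 + t * z.2) : rT, z.2 : rT)).
  apply: (measurableT_comp mf); apply: measurable_fun_pair => //.
  by apply: measurable_funD => //; exact: measurable_funM.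
rewrite [RHS](fubini_tonelli (m1 := mu) (m2 := mu) f mf f0).
rewrite [LHS](fubini_tonelli (m1 := mu) (m2 := mu) (fun z : rT * rT =>
    f ((z.1 + t * z.2) : rT, z.2 : rT)) mg (fun z => f0 _)).
apply: eq_integral => y _.
apply: (ge0_integral_translate (t * y) (fun x => f (x, y))) => //.
exact: (measurable_fun_pair1 y mf).
Qed.

Lemma ge0_integral_shear2 (t : R) (f : rT * rT -> \bar R) :
  measurable_fun setT f -> (forall z, 0 <= f z)%E ->
  (\int[mu]_x \int[mu]_y f (x, y + t * x)%R = \int[mu]_x \int[mu]_y f (x, y))%E.
Proof.
move=> mf f0; apply: eq_integral => x _.
apply: (ge0_integral_translate (t * x) (fun y => f (x, y))) => //.
exact: (measurable_fun_pair2 x mf).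
Qed.

Lemma measurable_fun_lin2 (a b c d : R) (f : rT * rT -> \bar R) :
  measurable_fun setT f ->
  measurable_fun setT (fun z : rT * rT => f (a * z.1 + b * z.2, c * z.1 + d * z.2)).
Proof.
move=> mf; apply: (measurableT_comp mf).
apply: (@measurable_fun_pair _ _ _ (rT * rT)%type
  (rT) (rT));
  by apply: measurable_funD => //; exact: measurable_funM.
Qed.

(* A rotation of angle [th] is the product of three shears, with parameters [tan (th / 2)],
   [- sin th] and [tan (th / 2)]. *)
Lemma ge0_integral_rotation (a b : R) (f : rT * rT -> \bar R) :
  a ^+ 2 + b ^+ 2 = 1 -> measurable_fun setT f -> (forall z, 0 <= f z)%E ->
  (\int[mu]_x \int[mu]_y f (a * x + b * y, - b * x + a * y)%R
    = \int[mu]_x \int[mu]_y f (x, y))%E.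
Proof.
have gen (c d : R) (g : rT * rT -> \bar R) : c != -1 ->
  c ^+ 2 + d ^+ 2 = 1 -> measurable_fun setT g -> (forall z, 0 <= g z)%E ->
  (\int[mu]_x \int[mu]_y g (c * x + d * y, - d * x + c * y)%R
    = \int[mu]_x \int[mu]_y g (x, y))%E.
  move=> c1 cd mg g0; have c10 : 1 + c != 0 by rewrite addrC -(opprK 1) subr_eq0.
  pose t := d / (1 + c).
  rewrite -(ge0_integral_shear1 t _ mg g0).
  pose g1 (z : rT * rT) := g ((z.1 + t * z.2 : rT), z.2).
  pose g2 (z : rT * rT) := g1 (z.1, (z.2 + - d * z.1 : rT)).
  have m1 : measurable_fun setT g1.
    apply: eq_measurable_fun (measurable_fun_lin2 1 t 0 1 _ mg) => z _.
    by rewrite /g1 !mul1r mul0r add0r.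
  have m2 : measurable_fun setT g2.
    apply: eq_measurable_fun (measurable_fun_lin2 1 0 (- d) 1 _ m1) => z _.
    by rewrite /g2; congr (g1 (_, _)); ring.
  rewrite -[RHS](ge0_integral_shear2 (- d) g1 m1 (fun z => g0 _)).
  rewrite -[RHS](ge0_integral_shear1 t g2 m2 (fun z => g0 _)).
  apply: eq_integral => x _; apply: eq_integral => y _; rewrite /g2 /g1 /=; congr (g (_, _)).
    have tE : t * (1 + c) = d by rewrite /t divfK.
    have dt : d * t = 1 - c.
      apply: (mulIf c10); rewrite -mulrA tE; have -> : d * d = 1 - c ^+ 2 by rewrite -cd; ring.
      by ring.
    have -> : x + t * y + t * (y + - d * (x + t * y)) = x * (1 - d * t) + y * (t * (2 - d * t)) by ring.
    rewrite dt; have -> : 2 - (1 - c) = 1 + c by ring.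
    by rewrite tE; ring.
  have dt : d * t = 1 - c.
    apply: (mulIf c10); rewrite -mulrA /t divfK //; have -> : d * d = 1 - c ^+ 2 by rewrite -cd; ring.
    by ring.
  have -> : y + - d * (x + t * y) = y - d * x - (d * t) * y by ring.
  by rewrite dt; ring.
(* At angle pi the tangent of the half angle is infinite, so that rotation is made of two quarter
   turns. *)
move=> ab mf f0; have [a1|an1] := eqVneq a (-1); last exact: (gen a b f an1 ab mf f0).
have b0 : b = 0.
  by move: ab; rewrite a1 sqrrN expr1n => /(congr1 (fun x => x - 1)); rewrite addrAC subrr add0r => /eqP; rewrite sqrf_eq0 => /eqP.
have n01 : (0 : R) != -1 by rewrite eq_sym oppr_eq0 oner_neq0.
have q01 : (0 : R) ^+ 2 + 1 ^+ 2 = 1 by rewrite expr0n add0r expr1n.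
rewrite -(gen 0 1 f n01 q01 mf f0).
rewrite -(gen 0 1 _ n01 q01 (measurable_fun_lin2 0 1 (- 1) 0 _ mf) (fun z => f0 _)) /=.
apply: eq_integral => x _; apply: eq_integral => y _; congr (f (_, _)); rewrite a1 b0; ring.
Qed.

Lemma normal_pdf01E (x : R) : normal_pdf 0 1 x = normal_peak 1 * expR (- (x ^+ 2 / 2)).
Proof.
rewrite normal_pdfE ?oner_neq0// /normal_fun; congr (_ * expR _).
by rewrite subr0 expr1n mulNr.
Qed.

(** The product density depends only on [x ^+ 2 + y ^+ 2], and Lebesgue measure on the plane is
    invariant under rotations. *)
Lemma gauss2_rotation (a b : R) (B1 B2 : set R) :
  a ^+ 2 + b ^+ 2 = 1 -> measurable B1 -> measurable B2 ->
  ((gam \x gam) [set z : rT * rT | B1 (a * z.1 + b * z.2)%R /\ B2 (- b * z.1 + a * z.2)%R]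
    = gam B1 * gam B2)%E.
Proof.
move=> ab mB1 mB2.
set gamp := (gam \x gam)%E.
have J (A : set (rT * rT)) : measurable A ->
  ((gam \x gam) A = \int[mu]_x \int[mu]_y
     (((\1_A (x, y) : R) * normal_pdf 0 1 y) * normal_pdf 0 1 x)%:E)%E.
  move=> mA.
  have mi : measurable_fun setT (fun z : rT * rT => (\1_A z : R)%:E).
    by apply/measurable_EFinP; exact: measurable_indic.
  have i0 (z : rT * rT) : (0 <= (\1_A z : R)%:E)%E by rewrite lee_fin.
  transitivity (\int[gamp]_z (\1_A z : R)%:E)%E.
    by rewrite (integral_indic gamp measurableT mA) setIT.
  rewrite (fubini_tonelli1 _ mi i0) ge0_integral_normal; last 2 first.
    exact: measurable_fun_fubini_tonelli_F.
    by move=> x; apply: integral_ge0.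
  apply: eq_integral => x _; rewrite /fubini_F.
  rewrite ge0_integral_normal//; last exact: (measurable_fun_pair2 x mi).
  rewrite -ge0_integralZr//; last 3 first.
  - apply: emeasurable_funM; first exact: (measurable_fun_pair2 x mi).
    by apply/measurable_EFinP; exact: measurable_normal_pdf.
  - by move=> y _; apply: mule_ge0 => //; rewrite lee_fin normal_pdf_ge0.
  - by rewrite lee_fin normal_pdf_ge0.
have mB : measurable ((B1 `*` B2) : set (rT * rT)).
  exact: measurableX.
have mL : measurable_fun setT (fun z : rT * rT =>
    ((a * z.1 + b * z.2) : rT, (- b * z.1 + a * z.2) : rT)).
  by apply: measurable_fun_pair; apply: measurable_funD => //; exact: measurable_funM.
have mC : measurable [set z : rT * rT | B1 (a * z.1 + b * z.2)%R /\ B2 (- b * z.1 + a * z.2)%R].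
  by have := mL measurableT _ mB; rewrite setTI.
apply: (etrans (J _ mC)); apply: esym; apply: (etrans (esym (product_measure1E gam gam mB1 mB2))).
apply: (etrans (J _ mB)).
have mF : measurable_fun setT (fun z : rT * rT =>
  (((\1_(B1 `*` B2) z : R) * normal_pdf 0 1 z.2) * normal_pdf 0 1 z.1)%:E).
  apply/measurable_EFinP; apply: measurable_funM; [apply: measurable_funM|].
  - exact: measurable_indic.
  - by apply: measurableT_comp => //; exact: measurable_normal_pdf.
  - by apply: measurableT_comp => //; exact: measurable_normal_pdf.
have F0 (z : rT * rT) : (0 <= (((\1_(B1 `*` B2) z : R) * normal_pdf 0 1 z.2) * normal_pdf 0 1 z.1)%:E)%E.
  by rewrite lee_fin !mulr_ge0// normal_pdf_ge0.
rewrite -[LHS](ge0_integral_rotation a b _ ab mF F0); symmetry.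
apply: eq_integral => x _; apply: eq_integral => y _; congr EFin => /=.
rewrite -!mulrA; congr (_ * _).
rewrite !normal_pdf01E mulrACA -expRD [RHS]mulrACA -expRD; congr (_ * expR _).
have -> : - (y ^+ 2 / 2) - x ^+ 2 / 2 = - ((x ^+ 2 + y ^+ 2) / 2) by ring.
rewrite -[x ^+ 2 + y ^+ 2]mul1r -ab; ring.
Qed.

(** The rotation of angle pi, read on the first coordinate. *)
Lemma normal_prob_sym (B : set rT) : measurable B -> gam (-%R @^-1` B) = gam B.
Proof.
move=> mB.
have q : (-1 : R) ^+ 2 + 0 ^+ 2 = 1 by rewrite sqrrN expr1n expr0n addr0.
have := gauss2_rotation (-1) 0 B setT q mB measurableT.
have -> : [set z : rT * rT | B (-1 * z.1 + 0 * z.2)%R /\ setT (- 0 * z.1 + -1 * z.2)%R] = (-%R @^-1` B) `*` setT.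
  by apply/seteqP; split => -[x y] /=; rewrite mulN1r mul0r addr0.
have mN : measurable (-%R @^-1` B : set rT).
  by rewrite -[X in measurable X]setTI; exact: (@oppr_measurable R setT measurableT).
rewrite (product_measure1E gam gam mN measurableT).
have gT : gam setT = 1%E := probability_setT gam.
rewrite gT !mule1 => <-; symmetry.
exact: (etrans (congr1 (mule (gam (-%R @^-1` B))) gT) (mule1 _)).
Qed.

End gauss2.

(** * Gaussian vectors independent of a random variable *)

Section restr_law.
Context {R : realType} {d d' : measure_display} {Om : measurableType d}
  {T : measurableType d'}.
Variables (P : probability Om R) (E : set Om) (Y : Om -> T).
Hypotheses (mE : measurable E) (mY : measurable_fun setT Y).

(** The unnormalised law of [Y] on [E], so that events of probability zero need no separate
    treatment. The measurability proofs are arguments in order that the measure structure can be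
    attached to the term. *)
Definition restr_law of measurable E & measurable_fun setT Y : set T -> \bar R :=
  fun A => P (E `&` Y @^-1` A).

Notation restr_lawE := (restr_law mE mY).

Let nu := restr_lawE.

Let mpre A : measurable A -> measurable (E `&` Y @^-1` A).
Proof. by move=> mA; apply: measurableI => //; rewrite -[X in measurable X]setTI; exact: mY. Qed.

Let nu0 : nu set0 = 0%E.
Proof. by rewrite /nu /restr_law preimage_set0 setI0 measure0. Qed.

Let nu_ge0 A : (0 <= nu A)%E.
Proof. exact: measure_ge0. Qed.

Let nu_sigma_additive : semi_sigma_additive nu.
Proof.
move=> F mF tF mUF; rewrite /nu /restr_law preimage_bigcup setI_bigcupr.
apply: measure_semi_sigma_additive.
- by move=> n; exact: mpre.
- apply/trivIsetP => /= i j _ _ ij; rewrite setIACA setIid -preimage_setI.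
  by move/trivIsetP : tF => /(_ _ _ _ _ ij) ->//; rewrite preimage_set0 setI0.
- by apply: bigcup_measurable => n _; exact: mpre.
Qed.

HB.instance Definition _ := isMeasure.Build _ _ _ restr_lawE
  nu0 nu_ge0 nu_sigma_additive.

Let nu_fin : fin_num_fun restr_lawE.
Proof.
by move=> A mA; rewrite ge0_fin_numE// (le_lt_trans (probability_le1 P (mpre A mA)))// ltry.
Qed.

HB.instance Definition _ := @Measure_isFinite.Build _ _ _ restr_lawE nu_fin.

End restr_law.
Arguments restr_law {R d d' Om T} P {E Y} mE mY _.

(** Uniqueness of the product measure. It extends independence from rectangles to sets whose section
    in the second variable varies with the first, as happens for a rotation whose angle depends on
    [Y]. *)
Lemma joint_law {R : realType} {d d1 d2 : measure_display} {Om : measurableType d}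
    {T1 : measurableType d1} {T2 : measurableType d2} (P : probability Om R)
    (E : set Om) (mE : measurable E) (Y : Om -> T1) (Z : Om -> T2)
    (mY : measurable_fun setT Y) (mZ : measurable_fun setT Z)
    (m1 : {sigma_finite_measure set T1 -> \bar R})
    (m2 : {sigma_finite_measure set T2 -> \bar R}) :
  (forall A B, measurable A -> measurable B ->
     P (E `&` (Y @^-1` A `&` Z @^-1` B)) = (m1 A * m2 B)%E) ->
  forall S : set (T1 * T2), measurable S ->
    P (E `&` [set w | S (Y w, Z w)]) = ((m1 \x m2) S)%E.
Proof.
move=> H S mS.
have mYZ := measurable_fun_pair mY mZ.
by rewrite (product_measure_unique (m' := restr_law P mE mYZ))// => A B mA mB; rewrite -H.
Qed.

Section gauss_given.
Context {R : realType} {d d' : measure_display} {Om : measurableType d}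
  {T : measurableType d'}.
Variables (P : probability Om R) (Y : Om -> T).
Hypothesis mY : measurable_fun setT Y.
Notation gam := (@normal_prob R 0 1).
Notation rT := (measurableTypeR R).

(* On the event [E], the vector [e] is standard Gaussian and independent of [Y]. Restricting
   to an event [E] is what lets the rows of an orthonormal matrix be peeled off one by one. *)
Definition gauss_given (E : set Om) {n : nat} (e : Om -> 'I_n -> R) : Prop :=
  (forall k, measurable_fun setT (fun w => e w k)) /\
  forall (D : set T) (B : 'I_n -> set R), measurable D -> (forall k, measurable (B k)) ->
    P ((E `&` Y @^-1` D) `&` [set w | forall k, B k (e w k)]) =
    (P (E `&` Y @^-1` D) * \prod_(k < n) gam (B k))%E.

Lemma measurable_box {n : nat} (e : Om -> 'I_n -> R) (B : 'I_n -> set R) :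
  (forall k, measurable_fun setT (fun w => e w k)) -> (forall k, measurable (B k)) ->
  measurable [set w | forall k, B k (e w k)].
Proof.
move=> me mB; have -> : [set w | forall k, B k (e w k)] = \bigcap_(k in [set: 'I_n]) ((fun w => e w k) @^-1` (B k)).
  by apply/seteqP; split => w /= H k; [move=> _; exact: H|exact: H].
apply: fin_bigcap_measurable; first exact: finite_finset.
by move=> k _; rewrite -[X in measurable X]setTI; exact: me.
Qed.

Definition givens {n : nat} (i j : 'I_n) (a b : R) (v : 'I_n -> R) (k : 'I_n) : R :=
  if k == i then a * v i + b * v j else if k == j then - b * v i + a * v j else v k.

(** Lets the rows of [W] and the noise be rotated together without changing the products of [W] with
    the noise. *)
Lemma sum_givens {n : nat} (i j : 'I_n) (a b : R) (u v : 'I_n -> R) :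
  i != j -> a ^+ 2 + b ^+ 2 = 1 ->
  \sum_k givens i j a b u k * givens i j a b v k = \sum_k u k * v k.
Proof.
move=> ij ab; rewrite (bigD1 i)//= (bigD1 j) 1?eq_sym//= [RHS](bigD1 i)//= [in RHS](bigD1 j) 1?eq_sym//=.
rewrite !addrA; congr (_ + _); last first.
  by apply: eq_bigr => k /andP[/negPf ki /negPf kj]; rewrite /givens ki kj.
rewrite /givens !eqxx eq_sym (negPf ij).
have -> : (a * u i + b * u j) * (a * v i + b * v j) +
  (- b * u i + a * u j) * (- b * v i + a * v j) = (a ^+ 2 + b ^+ 2) * (u i * v i + u j * v j) by ring.
by rewrite ab mul1r.
Qed.

(** Once the law of [(Y, e i, e j)] is known to be a product, the angle is constant on each section
    in [Y], and the planar invariance applies there. *)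
Lemma gauss_given_givens (E : set Om) {n : nat} (e : Om -> 'I_n -> R) (i j : 'I_n) (a b : T -> R) :
  measurable E -> i != j -> measurable_fun setT a -> measurable_fun setT b ->
  (forall x, a x ^+ 2 + b x ^+ 2 = 1) ->
  gauss_given E e -> gauss_given E (fun w => givens i j (a (Y w)) (b (Y w)) (e w)).
Proof.
move=> mE ij ma mb ab [me He]; split.
  move=> k; rewrite /givens; case: (k == i); [|case: (k == j) => //];
    apply: measurable_funD; apply: measurable_funM => //; do ?[exact: measurableT_comp];
    exact: (measurableT_comp (measurableT_comp (@oppr_measurable R setT) mb) mY).
move=> D B mD mB.
have ji : (j == i) = false by rewrite eq_sym; exact: negPf.
pose upd (C1 C2 : set R) k := if k == i then C1 else if k == j then C2 else B k.
have mupd C1 C2 : measurable C1 -> measurable C2 -> forall k, measurable (upd C1 C2 k).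
  by move=> m1 m2 k; rewrite /upd; case: ifP => // _; case: ifP.
(* The coordinates that the rotation leaves alone are absorbed into the event [E']; only [Y] and the
   pair [(e i, e j)] remain. *)
pose E' := E `&` [set w | forall k, upd setT setT k (e w k)].
have mE' : measurable E' by apply: measurableI => //; apply: measurable_box => //; exact: mupd.
pose c : \bar R := (\prod_(k < n | (k != i) && (k != j)) gam (B k))%E.
have prodE C1 C2 : (\prod_(k < n) gam (upd C1 C2 k) = gam C1 * gam C2 * c)%E.
  rewrite (bigD1 i)//= (bigD1 j) 1?eq_sym//= muleA; congr (_ * _ * _)%E.
  - by rewrite /upd eqxx.
  - by rewrite /upd ji eqxx.
  - by apply: eq_bigr => k /andP[/negPf ki /negPf kj]; rewrite /upd ki kj.
have HE A C1 C2 : measurable A -> measurable C1 -> measurable C2 ->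
  P (E' `&` (Y @^-1` A `&` ((fun w => e w i) @^-1` C1 `&` (fun w => e w j) @^-1` C2)))
  = (P (E `&` Y @^-1` A) * (gam C1 * gam C2 * c))%E.
  move=> mA m1 m2; rewrite -prodE -He//; last exact: mupd.
  congr (P _); apply/seteqP; split => w /=.
    move=> [[Ew H] [Aw [c1 c2]]]; split => // k; have := H k; rewrite /upd.
    by case: eqP => [->//|_]; case: eqP => [->//|].
  move=> [[Ew Aw] H]; split; [split=> // k|split => //; split].
  - by have := H k; rewrite /upd; case: ifP => // _; case: ifP.
  - by have := H i; rewrite /upd eqxx.
  - by have := H j; rewrite /upd ji eqxx.
have c0 : (0 <= c)%E by apply: prode_ge0 => k _; exact: measure_ge0.
have gT : gam setT = 1%E := probability_setT gam.
have HE' A : measurable A -> P (E' `&` Y @^-1` A) = (P (E `&` Y @^-1` A) * c)%E.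
  move=> mA; have := HE A setT setT mA measurableT measurableT.
  by rewrite !preimage_setT !setIT gT !mul1e.
pose m1 := restr_law P mE' mY.
have mei : measurable_fun setT (fun w => e w i : rT) := me i.
have mej : measurable_fun setT (fun w => e w j : rT) := me j.
pose T2 : measurableType _ := (rT * rT)%type.
pose Z : Om -> T2 := fun w => (e w i : rT, e w j : rT).
pose g2 : {sigma_finite_measure set T2 -> \bar R} := product_subprobability (gam : subprobability _ R, gam : subprobability _ R).
have mee : measurable_fun setT Z by exact: measurable_fun_pair.
have joint S : measurable S ->
    P (E' `&` [set w | S (Y w, Z w)]) = ((m1 \x g2) S)%E.
  move: S; apply: (joint_law P E' mE' Y Z mY mee m1 g2) => A C mA mC.
  have mE'A : measurable (E' `&` Y @^-1` A).
    by apply: measurableI => //; rewrite -[X in measurable X]setTI; exact: mY.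
  have k0 : (0 <= P (E' `&` Y @^-1` A))%E by exact: measure_ge0.
  have kfin : P (E' `&` Y @^-1` A) \is a fin_num by exact: fin_num_measure.
  have kf0 : 0 <= fine (P (E' `&` Y @^-1` A)) by exact: fine_ge0.
  pose q := restr_law P mE'A mei.
  have rect C1 C2 : measurable C1 -> measurable C2 ->
      P ((E' `&` Y @^-1` A) `&` ((fun w => e w i : rT) @^-1` C1 `&` (fun w => e w j : rT) @^-1` C2))
      = (q C1 * gam C2)%E.
    move=> mC1 mC2; rewrite /q /restr_law -setIA HE//.
    have := HE A C1 setT mA mC1 measurableT; rewrite preimage_setT setIT gT mule1 setIA => ->.
    by rewrite -!muleA; congr (_ * (_ * _))%E; rewrite muleC.
  rewrite setIA (joint_law P _ mE'A _ _ mei mej q gam rect) //.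
  have g2E C1 C2 : measurable C1 -> measurable C2 -> g2 (C1 `*` C2) = (gam C1 * gam C2)%E.
    by move=> mC1 mC2; exact: (product_measure1E gam gam mC1 mC2).
  pose q2 : measure T2 R := mscale (NngNum kf0) g2.
  have q2E X : q2 X = (P (E' `&` Y @^-1` A) * g2 X)%E.
    by rewrite -[in RHS](fineK kfin).
  rewrite (product_measure_unique (m' := q2)) // => C1 C2 mC1 mC2.
  rewrite q2E g2E//.
  have := HE A C1 setT mA mC1 measurableT; rewrite preimage_setT setIT gT mule1 setIA => HC.
  apply: (@etrans _ _ ((P (E `&` Y @^-1` A) * (gam C1 * c)) * gam C2)%E); last first.
    by congr (_ * _)%E; exact: esym HC.
  by rewrite HE'//; rewrite -!muleA; congr (_ * _)%E; rewrite muleCA muleC -muleA [(gam C2 * c)%E]muleC.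
pose S := [set x : T * (rT * rT) | [/\ D x.1, B i (a x.1 * x.2.1 + b x.1 * x.2.2) &
   B j (- b x.1 * x.2.1 + a x.1 * x.2.2)]].
have mS : measurable S.
  have ma1 : measurable_fun setT (fun x : T * (rT * rT) => a x.1 : rT) by exact: measurableT_comp.
  have mb1 : measurable_fun setT (fun x : T * (rT * rT) => b x.1 : rT) by exact: measurableT_comp.
  have mNb : measurable_fun setT (fun x : T * (rT * rT) => - b x.1 : rT).
    exact: (measurableT_comp (@oppr_measurable R setT) mb1).
  have mx1 : measurable_fun setT (fun x : T * (rT * rT) => x.2.1 : rT).
    exact: (measurableT_comp measurable_fst measurable_snd).
  have mx2 : measurable_fun setT (fun x : T * (rT * rT) => x.2.2 : rT).
    exact: (measurableT_comp measurable_snd measurable_snd).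
  have m1f : measurable_fun setT (fun x : T * (rT * rT) => (a x.1 * x.2.1 + b x.1 * x.2.2) : rT).
    by apply: measurable_funD; exact: measurable_funM.
  have m2f : measurable_fun setT (fun x : T * (rT * rT) => (- b x.1 * x.2.1 + a x.1 * x.2.2) : rT).
    by apply: measurable_funD; exact: measurable_funM.
  have -> : S = (fst @^-1` D) `&` ((fun x : T * (rT * rT) => (a x.1 * x.2.1 + b x.1 * x.2.2) : rT) @^-1` B i `&`
     (fun x : T * (rT * rT) => (- b x.1 * x.2.1 + a x.1 * x.2.2) : rT) @^-1` B j).
    by apply/seteqP; split => x /= [] // ? []; split.
  apply: measurableI; [|apply: measurableI]; rewrite -[X in measurable X]setTI.
  - exact: measurable_fst.
  - exact: (m1f measurableT _ (mB i)).
  - exact: (m2f measurableT _ (mB j)).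
have -> : E `&` Y @^-1` D `&` [set w | forall k, B k (givens i j (a (Y w)) (b (Y w)) (e w) k)]
   = E' `&` [set w | S (Y w, (e w i : rT, e w j : rT))].
  apply/seteqP; split => w /=.
    move=> [[Ew Dw] H]; split; [split => // k|split => //].
    - rewrite /upd; have := H k; rewrite /givens; case: eqP => // _; case: eqP => //.
    - by have := H i; rewrite /givens eqxx.
    - by have := H j; rewrite /givens eqxx ji.
  move=> [[Ew H] [Dw Hi Hj]]; split => // k; rewrite /givens.
  by have := H k; rewrite /upd; case: eqP => [->//|_]; case: eqP => [->//|].
rewrite (joint _ mS) /product_measure1.
(* For fixed [x] in [D] the section of [S] is a rotated rectangle, of measure
   [gam (B i) * gam (B j)]; outside [D] it is empty. *)
transitivity (\int[m1]_x ((\1_D x : R)%:E * (gam (B i) * gam (B j))))%E.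
  apply: eq_integral => x _ /=; rewrite indicE.
  have [xD|xD] := boolP (x \in D).
    rewrite mul1e -(gauss2_rotation _ _ _ _ (ab x) (mB i) (mB j)); congr (_ _).
    by apply/seteqP; split => z; rewrite /xsection /= ?inE /S /=; [case|case=> h1 h2; split => //; exact/set_mem].
  rewrite mul0e; have -> : xsection S x = set0; last by rewrite measure0.
  apply/seteqP; split => z //; rewrite /xsection /= inE /S /= => -[Dx _ _].
  by move/negP: xD; apply; exact/mem_set.
rewrite ge0_integralZr//; last 2 first.
- by apply/measurable_EFinP; exact: measurable_indic.
- by rewrite mule_ge0.
rewrite (integral_indic m1 measurableT mD) setIT.
apply: (@etrans _ _ ((P (E `&` Y @^-1` D) * c) * (gam (B i) * gam (B j)))%E).
  by congr (_ * _)%E; exact: HE'.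
rewrite -muleA; congr (_ * _)%E; rewrite muleC; have := prodE (B i) (B j) => <-.
apply: eq_bigr => k _; rewrite /upd.
by case: eqP => [->//|_]; case: eqP => [->//|].
Qed.

End gauss_given.

Section gauss_orthonormal.
Context {R : realType} {d d' : measure_display} {Om : measurableType d}
  {T : measurableType d'}.
Variables (P : probability Om R) (Y : Om -> T).
Hypothesis mY : measurable_fun setT Y.
Notation gam := (@normal_prob R 0 1).
Notation gauss_given := (gauss_given P Y).

Let cons_box {n : nat} (C : set R) (B : 'I_n -> set R) (k : 'I_n.+1) : set R :=
  if unlift ord0 k is Some k' then B k' else C.

(** The constraint on the first coordinate becomes part of the event, so that the induction on the
    rows can go on with the remaining coordinates. *)
Lemma gauss_given_behead (E : set Om) {n : nat} (e : Om -> 'I_n.+1 -> R) (C : set R) :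
  measurable C -> gauss_given E e ->
  gauss_given (E `&` (fun w => e w ord0) @^-1` C) (fun w k => e w (lift ord0 k)) /\
  forall D, measurable D ->
    P (E `&` (fun w => e w ord0) @^-1` C `&` Y @^-1` D) = (P (E `&` Y @^-1` D) * gam C)%E.
Proof.
move=> mC [me He].
have H (D : set T) (B : 'I_n -> set R) : measurable D -> (forall k, measurable (B k)) ->
   P ((E `&` (fun w => e w ord0) @^-1` C `&` Y @^-1` D) `&` [set w | forall k, B k (e w (lift ord0 k))])
   = (P (E `&` Y @^-1` D) * gam C * \prod_(k < n) gam (B k))%E.
  move=> mD mB; have := He D (cons_box C B) mD; rewrite big_ord_recl.
  have -> : cons_box C B ord0 = C by rewrite /cons_box unlift_none.
  rewrite -muleA.
  have -> : (\prod_(i < n) gam (cons_box C B (lift ord0 i)) = \prod_(k < n) gam (B k))%E.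
    by apply: eq_bigr => k _; rewrite /cons_box liftK.
  move=> <-; last by move=> k; rewrite /cons_box; case: unliftP.
  congr (P _); apply/seteqP; split => w /=.
    move=> [[[Ew Cw] Dw] Bw]; split => // k; rewrite /cons_box.
    by case: unliftP => [k' ->|->].
  move=> [[Ew Dw] Bw]; split; [split => //; split => //|].
    by have := Bw ord0; rewrite /cons_box unlift_none.
  by move=> k; have := Bw (lift ord0 k); rewrite /cons_box liftK.
have H1 D : measurable D ->
    P (E `&` (fun w => e w ord0) @^-1` C `&` Y @^-1` D) = (P (E `&` Y @^-1` D) * gam C)%E.
  move=> mD; have := H D (fun=> setT) mD (fun=> measurableT).
  rewrite big1 ?mule1; last by move=> k _; exact: (probability_setT gam).
  by move=> <-; congr (P _); apply/seteqP; split => w /= => [|[]].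
split => //; split; first by move=> k; exact: me.
by move=> D B mD mB; rewrite H// H1.
Qed.

(* Givens rotations with [Y]-measurable angles bring the first row of [W] to plus or minus
   the first coordinate vector; the remaining rows are then handled by induction. *)
Lemma gauss_given_orthonormal (p n : nat) (E : set Om) (e : Om -> 'I_n -> R)
    (W : T -> 'I_p -> 'I_n -> R) :
  measurable E -> (forall i k, measurable_fun setT (fun x => W x i k)) ->
  (forall x i i', \sum_k W x i k * W x i' k = (i == i')%:R) ->
  gauss_given E e ->
  gauss_given E (fun w i => \sum_k W (Y w) i k * e w k).
Proof.
elim: p n E e W => [|p IHp] n E e W mE mW WW He.
  split; first by case.
  move=> D B mD mB; rewrite big_ord0 mule1; congr (P _).
  by apply/seteqP; split => w /= => [[]//|Ew]; split => // -[].
case: n e W mW WW He => [|n] e W mW WW He.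
  have := WW point ord0 ord0; rewrite big_ord0 eqxx => /eqP.
  by rewrite eq_sym oner_eq0.
(* [m] bounds the positions of the nonzero entries in the first row; the step from [m.+1] to [m]
   clears entry [m.+1] by a rotation in the plane of coordinates 0 and [m.+1]. *)
suff L (m : nat) : forall (e : Om -> 'I_n.+1 -> R) (W : T -> 'I_p.+1 -> 'I_n.+1 -> R),
  (forall i k, measurable_fun setT (fun x => W x i k)) ->
  (forall x i i', \sum_k W x i k * W x i' k = (i == i')%:R) ->
  (forall x (k : 'I_n.+1), (m < k)%N -> W x ord0 k = 0) ->
  gauss_given E e -> gauss_given E (fun w (i : 'I_p.+1) => \sum_k W (Y w) i k * e w k).
  by apply: (L n) => // x k; rewrite ltnNge -ltnS ltn_ord.
elim: m {e W mW WW He} => [|m IHm] e W mW WW W0 He; last first.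
  have [mn|nm] := ltnP m n; last first.
    apply: IHm => // x k mk; move: (leq_trans mk (leq_trans (leq_ord k) nm)).
    by rewrite ltnn.
  pose j : 'I_n.+1 := Ordinal (mn : (m.+1 < n.+1)%N).
  have j0 : ord0 != j by [].
  pose q x := W x ord0 ord0 ^+ 2 + W x ord0 j ^+ 2.
  pose rq x := q x `^ (- 2^-1).
  have q_ge0 x : 0 <= q x by rewrite addr_ge0// sqr_ge0.
  have rq2 x : rq x ^+ 2 = (q x)^-1.
    by rewrite /rq powRN powR12_sqrt// exprVn sqr_sqrtr.
  (* Where both entries vanish the angle is free; there [b x] is 0, so [a x = 1] gives the identity
     rotation. *)
  pose a x := if q x == 0 then 1 else W x ord0 ord0 * rq x.
  pose b x := W x ord0 j * rq x.
  have Wj0 x : q x = 0 -> W x ord0 j = 0.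
    move=> /eqP; rewrite paddr_eq0 ?sqr_ge0// => /andP[_].
    by rewrite sqrf_eq0 => /eqP.
  have ab x : a x ^+ 2 + b x ^+ 2 = 1.
    rewrite /a /b; case: eqP => [q0|/eqP q0].
      by rewrite (Wj0 _ q0) mul0r expr1n expr0n addr0.
    by rewrite !exprMn -mulrDl rq2 divff.
  have mq : measurable_fun setT q by apply: measurable_funD; apply: measurable_funX.
  have mrq : measurable_fun setT rq.
    exact: (measurableT_comp (@measurable_powR R (- 2^-1)) mq).
  have ma : measurable_fun setT a.
    apply: measurable_fun_ifT => //; last exact: measurable_funM.
    by apply: measurable_fun_eqr.
  have mb : measurable_fun setT b by exact: measurable_funM.
  have := IHm (fun w => givens ord0 j (a (Y w)) (b (Y w)) (e w))
     (fun x i => givens ord0 j (a x) (b x) (W x i)).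
  have -> : (fun w (i : 'I_p.+1) => \sum_k givens ord0 j (a (Y w)) (b (Y w)) (W (Y w) i) k *
      givens ord0 j (a (Y w)) (b (Y w)) (e w) k) = (fun w i => \sum_k W (Y w) i k * e w k).
    by apply/funext => w; apply/funext => i; rewrite sum_givens.
  apply.
  - move=> i k; rewrite /givens; case: (k == _); [|case: (k == _) => //].
      by apply: measurable_funD; exact: measurable_funM.
    by apply: measurable_funD; apply: measurable_funM => //; exact: measurable_funN.
  - by move=> x i i'; rewrite sum_givens.
  - move=> x k mk; rewrite /givens; case: eqP => [k0|_]; first by move: mk; rewrite k0.
    case: eqP => [_|kj].
      rewrite /a /b; case: eqP => [/Wj0 ->|_]; first by rewrite mul0r oppr0 mul0r mulr0 addr0.
      by ring.
    apply: W0; rewrite ltn_neqAle mk andbT; apply/eqP => mk'; apply: kj.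
    exact/val_inj.
  - by apply: gauss_given_givens.
(* The first row is now its first entry, of square 1, followed by zeros. Orthogonality clears the
   rest of the first column, and the remaining block is again orthonormal. *)
have W0k x k : W x ord0 (lift ord0 k) = 0 by apply: W0.
have W00 x : W x ord0 ord0 ^+ 2 = 1.
  have := WW x ord0 ord0; rewrite big_ord_recl big1 ?addr0 ?eqxx//.
  by move=> k _; rewrite W0k mul0r.
have Wi0 x (i : 'I_p) : W x (lift ord0 i) ord0 = 0.
  have := WW x (lift ord0 i) ord0; rewrite big_ord_recl big1 ?addr0; last first.
    by move=> k _; rewrite W0k mulr0.
  rewrite (_ : (lift ord0 i == ord0) = false)// => /eqP.
  rewrite mulf_eq0 => /orP[/eqP//|/eqP w0].
  by have := W00 x; rewrite w0 expr0n => /eqP; rewrite eq_sym oner_eq0.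
pose W' x (i : 'I_p) (k : 'I_n) := W x (lift ord0 i) (lift ord0 k).
have WW' x i i' : \sum_k W' x i k * W' x i' k = (i == i')%:R.
  have := WW x (lift ord0 i) (lift ord0 i').
  by rewrite big_ord_recl Wi0 mul0r add0r (inj_eq lift_inj).
have me : forall k, measurable_fun setT (fun w => e w k) by case: He.
split.
  move=> i; apply: measurable_sum => k; apply: measurable_funM => //.
  exact: (measurableT_comp (mW i k) mY).
move=> D B mD mB.
(* The sign of the leading entry may depend on [Y], so [D] is split according to it; the symmetry of
   [gam] absorbs the sign -1. *)
pose D1 c := D `&` (fun x => W x ord0 ord0) @^-1` [set c].
have mD1 c : measurable (D1 c).
  by apply: measurableI => //; rewrite -[X in measurable X]setTI; apply: mW.
pose BC (c : R) : set R := (fun y => c * y) @^-1` B ord0.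
have half c : c = 1 \/ c = -1 -> P (E `&` Y @^-1` (D1 c) `&`
    [set w | forall i : 'I_p.+1, B i (\sum_k W (Y w) i k * e w k)])
    = (P (E `&` Y @^-1` (D1 c)) * \prod_(k < p.+1) gam (B k))%E.
  move=> cE.
  have mBC : measurable (BC c).
    rewrite /BC -[X in measurable X]setTI.
    by apply: (@measurable_funM _ _ _ setT (fun=> c) (fun y : R => y)).
  have gBC : gam (BC c) = gam (B ord0).
    case: cE => ->; last first.
      rewrite -(normal_prob_sym _ (mB ord0)); congr (gam _).
      by apply/seteqP; split => y; rewrite /BC /= mulN1r.
    by congr (gam _); apply/seteqP; split => y; rewrite /BC /= mul1r.
  have [He1 HE1] := gauss_given_behead E e (BC c) mBC He.
  have mE1 : measurable (E `&` (fun w => e w ord0) @^-1` (BC c)).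
    by apply: measurableI => //; rewrite -[X in measurable X]setTI; exact: me.
  have [_] := IHp n _ _ W' mE1 (fun i k => mW _ _) WW' He1.
  move=> /(_ (D1 c) (fun i => B (lift ord0 i)) (mD1 c) (fun i => mB _)).
  rewrite HE1// gBC big_ord_recl muleA => <-.
  congr (P _); apply/seteqP; split => w /=.
    move=> [[Ew [Dw Wc]] H]; split; [split => //; split => //|].
      have := H ord0; rewrite big_ord_recl big1 ?addr0 ?Wc//.
      by move=> k _; rewrite W0k mul0r.
    by move=> i; have := H (lift ord0 i); rewrite big_ord_recl Wi0 mul0r add0r.
  move=> [[[Ew Cw] [Dw Wc]] H]; split => // i; have [i' ->|->] := unliftP ord0 i.
    by rewrite big_ord_recl Wi0 mul0r add0r; exact: H.
  rewrite big_ord_recl big1 ?addr0; last by move=> k _; rewrite W0k mul0r.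
  by rewrite Wc.
have mbox : measurable [set w | forall i : 'I_p.+1, B i (\sum_k W (Y w) i k * e w k)].
  apply: (@measurable_box _ _ _ p.+1 (fun w i => \sum_k W (Y w) i k * e w k)) => // i.
  apply: measurable_sum => k; apply: measurable_funM => //.
  exact: (measurableT_comp (mW i k) mY).
have mpre c : measurable (E `&` Y @^-1` (D1 c)).
  by apply: measurableI => //; rewrite -[X in measurable X]setTI; exact: mY.
have dj : D1 1 `&` D1 (-1) = set0.
  apply/seteqP; split => x // -[[_ h1] [_ h2]].
  have /eqP : 1 = -1 :> R by rewrite -[LHS]h1 -[RHS]h2.
  by rewrite -subr_eq0 opprK paddr_eq0// oner_eq0.
have DU : D = D1 1 `|` D1 (-1).
  apply/seteqP; split => x /=; last by case=> -[].
  move=> Dx; have /eqP := W00 x; rewrite sqrf_eq1 => /orP[] /eqP ?; [left|right]; split => //.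
have preU : E `&` Y @^-1` D = (E `&` Y @^-1` (D1 1)) `|` (E `&` Y @^-1` (D1 (-1))).
  by rewrite -setIUr -preimage_setU -DU.
have preI : (E `&` Y @^-1` (D1 1)) `&` (E `&` Y @^-1` (D1 (-1))) = set0.
  by rewrite setIACA setIid -preimage_setI dj preimage_set0 setI0.
rewrite preU setIUl measureU; last 3 first.
- exact: measurableI.
- exact: measurableI.
- by rewrite setIACA preI set0I.
rewrite [in RHS]measureU// ge0_muleDl//.
by congr (_ + _)%E; apply: half; [left|right].
Qed.

End gauss_orthonormal.

(** * Spectral calculus and the whitening matrix *)

Section spectral.
Context {R : realType}.

(** The characteristic polynomial has a complex root; with [v] an eigenvector and [vs] its conjugate
    transpose, the number [v *m MC *m vs] is its own conjugate, so the root is real and is an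
    eigenvalue over [R]. *)
Lemma symmx_real_eigenvalue {p : nat} (M : 'M[R]_p.+1) :
  M^T = M -> exists2 v : 'rV[R]_p.+1, v != 0 & exists a : R, v *m M = a *: v.
Proof.
move=> Ms; pose rc : R -> R[i] := real_complex R.
pose MC := map_mx rc M.
have [a aM] := @eigenvalue_closed R[i] p.+1 MC isT.
have rcJ (x : R) : Num.conj (rc x) = rc x by exact: conjc_real.
have a_real : Num.conj a = a.
  have /eigenvalueP [v vM v0] := aM.
  pose vs := (map_mx Num.conj v)^T.
  have nv : (v *m vs) 0 0 != 0.
    rewrite mxE psumr_neq0; last by move=> k _; rewrite !mxE mul_conjC_ge0.
    have /rV0Pn [k vk] := v0; apply/hasP; exists k; first by rewrite mem_index_enum.
    by rewrite !mxE lt0r mul_conjC_ge0 mul_conjC_eq0 vk.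
  have E1 : (v *m MC *m vs) 0 0 = a * (v *m vs) 0 0 by rewrite vM -scalemxAl mxE.
  have MCs : (map_mx Num.conj MC)^T = MC.
    by apply/matrixP => i j; rewrite !mxE rcJ -[in RHS]Ms mxE.
  have E2 : (v *m MC *m vs) 0 0 = Num.conj a * (v *m vs) 0 0.
    have -> : (v *m MC *m vs) 0 0 = Num.conj ((v *m MC *m vs) 0 0).
      have H : v *m MC *m vs = (map_mx Num.conj (v *m MC *m vs))^T.
        rewrite !map_mxM !trmx_mul MCs -mulmxA; congr (_ *m _).
        apply/matrixP => i j; rewrite /vs !mxE; exact: (esym (conjCK _)).
      by rewrite {1}H !mxE.
    rewrite E1 rmorphM; congr (_ * _); rewrite !mxE rmorph_sum; apply: eq_bigr => k _.
    by rewrite !mxE rmorphM mulrC; congr (_ * _); exact: conjCK.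
  by apply: (mulIf nv); rewrite -E2 E1.
have aE : a = rc (complex.Re a).
  move: a_real; case: (a) => x y /= /eqP; rewrite eq_complex /= eqxx /= => /eqP.
  move=> H; have y0 : y = 0 by lra.
  by rewrite y0.
have : eigenvalue M (complex.Re a).
  move: aM; rewrite !eigenvalue_root_char -map_char_poly aE.
  by rewrite fmorph_root.
by move=> /eigenvalueP [v vM v0]; exists v => //; exists (complex.Re a).
Qed.


(** [H] is the Householder reflection exchanging [v] and the first coordinate vector. Its formula
    divides by the squared distance [q] between the two, hence the separate case where they
    coincide. *)
Lemma orthogonal_row_completion {p : nat} (v : 'rV[R]_p.+1) : (v *m v^T) 0 0 = 1 ->
  exists H : 'M[R]_p.+1, [/\ H^T = H, H *m H = 1%:M & delta_mx 0 0 *m H = v :> 'rV_p.+1].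
Proof.
move=> v1; pose e : 'rV[R]_p.+1 := delta_mx 0 0.
have [->|ve] := eqVneq v e.
  by exists 1%:M; rewrite trmx1 mul1mx mulmx1.
pose u := v - e; pose q := (u *m u^T) 0 0.
have ee : (e *m e^T) 0 0 = 1 by rewrite trmx_delta mul_delta_mx mxE !eqxx.
have evE : (e *m v^T) 0 0 = v 0 0.
  by rewrite mxE (bigD1 0)//= big1 ?addr0 ?mxE ?eqxx ?mul1r// => k k0; rewrite !mxE (negPf k0) andbF mul0r.
have veE : (v *m e^T) 0 0 = v 0 0.
  by rewrite mxE (bigD1 0)//= big1 ?addr0 ?mxE ?eqxx ?mulr1// => k k0; rewrite !mxE (negPf k0) andbF mulr0.
have qE : q = 2 - 2 * v 0 0.
  have -> : q = (v *m v^T) 0 0 - (v *m e^T) 0 0 - ((e *m v^T) 0 0 - (e *m e^T) 0 0).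
    by rewrite /q /u linearB /= mulmxBl !mulmxBr [LHS]mxE [X in X + _]mxE [X in _ + X = _]mxE
      [X in _ + (- X)]mxE [X in _ - (_ + X) = _]mxE [X in (_ + X) + _ = _]mxE.
  by rewrite v1 veE evE ee; ring.
have q0 : q != 0.
  rewrite /q mxE psumr_neq0; last by move=> k _; rewrite !mxE -expr2 sqr_ge0.
  have /rV0Pn [k uk] : u != 0 by rewrite subr_eq0.
  apply/hasP; exists k; first by rewrite mem_index_enum.
  by rewrite !mxE in uk *; rewrite -expr2 lt0r sqr_ge0 sqrf_eq0 uk.
have uuT : u *m u^T = q%:M by rewrite [LHS]mx11_scalar.
pose H := 1%:M - (2 / q) *: (u^T *m u).
exists H; split.
- by rewrite /H linearB /= trmx1 linearZ /= trmx_mul trmxK.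
- have PP : (u^T *m u) *m (u^T *m u) = q *: (u^T *m u).
    by rewrite mulmxA -[u^T *m u *m u^T]mulmxA uuT mul_mx_scalar -scalemxAl.
  rewrite /H; move: (u^T *m u) PP => A AA.
  rewrite mulmxBr mulmx1 mulmxBl mul1mx -scalemxAl -scalemxAr AA !scalerA.
  by apply/matrixP => i j; rewrite !mxE; field.
- rewrite -/e /H mulmxBr mulmx1 -scalemxAr mulmxA.
  have -> : e *m u^T = (v 0 0 - 1)%:M.
    rewrite [LHS]mx11_scalar /u linearB /= mulmxBr; congr (_%:M).
    by rewrite [LHS]mxE [X in _ + X]mxE evE ee.
  rewrite mul_scalar_mx scalerA.
  have -> : 2 / q * (v 0 0 - 1) = -1 by rewrite qE; field; rewrite -qE.
  by rewrite scaleN1r opprK /u addrC subrK.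
Qed.

(** Deflation: conjugating by the reflection that exchanges a unit eigenvector and the first
    coordinate vector leaves a 1 by 1 block and a smaller symmetric block. *)
Lemma spectral_dec_exists {p : nat} (M : 'M[R]_p) : M^T = M -> exists Od, spectral_dec M Od.
Proof.
elim: p M => [|p IHp] M Ms.
  by exists (0, 0); split; apply/matrixP => -[].
have [v0 v00 [a vM0]] := symmx_real_eigenvalue M Ms.
pose c := (v0 *m v0^T) 0 0.
have c_gt0 : 0 < c.
  rewrite lt0r /c mxE sumr_ge0 ?andbT; last by move=> k _; rewrite !mxE -expr2 sqr_ge0.
  rewrite psumr_neq0; last by move=> k _; rewrite !mxE -expr2 sqr_ge0.
  have /rV0Pn [k vk] := v00; apply/hasP; exists k; first by rewrite mem_index_enum.
  by rewrite !mxE -expr2 lt0r sqr_ge0 sqrf_eq0 vk.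
pose v := (Num.sqrt c)^-1 *: v0.
have vM : v *m M = a *: v by rewrite -scalemxAl vM0 !scalerA mulrC.
have v1 : (v *m v^T) 0 0 = 1.
  rewrite /v linearZ /= -scalemxAl -scalemxAr scalerA mxE -/c -expr2 exprVn sqr_sqrtr ?ltW//.
  by rewrite mulVf// gt_eqF.
have [H [HT HH Hv]] := orthogonal_row_completion v v1.
pose e : 'rV[R]_(1 + p) := delta_mx 0 0.
pose N : 'M[R]_(1 + p) := H *m M *m H.
have NT : N^T = N by rewrite /N !trmx_mul HT Ms mulmxA.
have eN : e *m N = a *: e.
  by rewrite /N !mulmxA Hv vM -scalemxAl -{1}Hv -mulmxA HH mulmx1.
have N0 j : N 0 j = a * (j == 0)%:R.
  have := congr1 (fun A : 'rV_(1 + p) => A 0 j) eN; rewrite -rowE !mxE => ->.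
  by rewrite eqxx.
have MN : M = H *m N *m H.
  by rewrite /N !mulmxA HH mul1mx -mulmxA HH mulmx1.
clearbody N.
have LT : (drsubmx N)^T = drsubmx N by rewrite trmx_drsub NT.
have [[U L] [/= UU ME]] := IHp _ LT.
have NE : N = block_mx a%:M 0 0 (drsubmx N).
  have lE : lshift p (0 : 'I_1) = 0 :> 'I_(1 + p) by exact/val_inj.
  have rE j : (rshift 1 j == 0 :> 'I_(1 + p)) = false by [].
  rewrite -{1}[N]submxK; congr block_mx; apply/matrixP => i j; rewrite !mxE ?ord1 ?lE.
  - by rewrite N0 eqxx mulr1 mulr1n.
  - by rewrite N0 rE mulr0.
  - by rewrite -NT mxE N0 rE mulr0.
pose Q : 'M[R]_(1 + p) := block_mx 1%:M 0 0 U.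
pose D : 'rV[R]_(1 + p) := row_mx a%:M L.
exists (H *m Q, D); rewrite /spectral_dec /=.
have QQ : Q^T *m Q = 1%:M.
  rewrite /Q tr_block_mx mulmx_block !trmx0 trmx1 !mul0mx !mulmx0 mul1mx !addr0 add0r UU.
  by rewrite -scalar_mx_block.
have NQ : N = Q *m diag_mx D *m Q^T.
  rewrite NE /Q /D diag_mx_row tr_block_mx !mulmx_block !trmx0 trmx1 !mul0mx !mulmx0 !mul1mx !mulmx1 !addr0 !add0r.
  rewrite mul0mx -ME; congr block_mx.
  by rewrite [RHS]mx11_scalar !mxE eqxx.
split; first by rewrite trmx_mul HT mulmxA -[Q^T *m H *m H]mulmxA HH mulmx1.
by rewrite MN NQ trmx_mul HT !mulmxA.
Qed.

End spectral.

Section fcalc.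
Context {R : realType} {p : nat} {U : 'M[R]_p} {L : 'rV[R]_p}.
Hypothesis UU : U^T *m U = 1%:M.
Implicit Types f g : R -> R.

Definition fcalc f : 'M[R]_p := U *m diag_mx (map_mx f L) *m U^T.

Lemma fcalcM f g : fcalc f *m fcalc g = fcalc (fun x => f x * g x).
Proof.
rewrite /fcalc !mulmxA -[U *m diag_mx _ *m U^T *m U]mulmxA UU mulmx1.
rewrite -[U *m diag_mx _ *m diag_mx _]mulmxA mulmx_diag.
by congr (_ *m diag_mx _ *m _); apply/rowP => i; rewrite !mxE.
Qed.

Lemma fcalcB f g : fcalc f - fcalc g = fcalc (fun x => f x - g x).
Proof.
rewrite /fcalc -mulmxBl -mulmxBr -linearB /=.
by congr (_ *m diag_mx _ *m _); apply/rowP => i; rewrite !mxE.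
Qed.

Lemma fcalcZ a f : a *: fcalc f = fcalc (fun x => a * f x).
Proof.
rewrite /fcalc scalemxAl scalemxAr -linearZ /=.
by congr (_ *m diag_mx _ *m _); apply/rowP => i; rewrite !mxE.
Qed.

Lemma fcalc_cst a : fcalc (fun=> a) = a%:M.
Proof.
rewrite /fcalc (_ : map_mx _ _ = const_mx a); last by apply/rowP => i; rewrite !mxE.
by rewrite diag_const_mx mul_mx_scalar -scalemxAl (mulmx1C UU) scalemx1.
Qed.

Lemma tr_fcalc f : (fcalc f)^T = fcalc f.
Proof. by rewrite /fcalc !trmx_mul trmxK tr_diag_mx mulmxA. Qed.

Lemma fcalc_sqnorm f (b : 'cV[R]_p) :
  \sum_j (fcalc f *m b) j 0 ^+ 2 = \sum_i f (L 0 i) ^+ 2 * (U^T *m b) i 0 ^+ 2.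
Proof.
have -> : \sum_j (fcalc f *m b) j 0 ^+ 2 = ((fcalc f *m b)^T *m (fcalc f *m b)) 0 0.
  by rewrite [RHS]mxE; apply: eq_bigr => j _; rewrite [in RHS]mxE expr2.
rewrite trmx_mul tr_fcalc mulmxA -[b^T *m _ *m _]mulmxA fcalcM /fcalc.
have -> : b^T *m (U *m diag_mx (map_mx (fun x => f x * f x) L) *m U^T) *m b =
  (U^T *m b)^T *m (diag_mx (map_mx (fun x => f x * f x) L) *m (U^T *m b)).
  by rewrite trmx_mul trmxK !mulmxA.
rewrite mul_diag_mx [LHS]mxE; apply: eq_bigr => i _; rewrite !mxE; ring.
Qed.

End fcalc.
Arguments fcalc {R p} U L f.

Section invsqrt.
Context {R : realType}.

(** Existence of a spectral decomposition makes the choice by [xget] a genuine one. All later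
    computations use this chosen pair, so independence of the choice never has to be discussed. *)
Lemma posdef_gram_spectral {n p : nat} (X : 'M[R]_(n, p)) : posdefmx (X^T *m X) ->
  exists U L, [/\ U^T *m U = 1%:M, X^T *m X = fcalc U L id,
    invsqrtmx (X^T *m X) = fcalc U L (fun x => (Num.sqrt x)^-1) &
    forall i, 0 < L 0 i].
Proof.
move=> pX; set M := X^T *m X in pX *.
have Ms : M^T = M by rewrite /M trmx_mul trmxK.
have [Od HOd] := spectral_dec_exists M Ms.
have := @xgetPex _ (0, 0) (spectral_dec M) (ex_intro _ Od HOd).
rewrite /invsqrtmx; case: xget => U L [/= UU ML].
exists U, L; split => //.
  by rewrite {1}ML /fcalc; congr (_ *m diag_mx _ *m _); apply/rowP => i; rewrite mxE.
move=> i; pose v : 'cV[R]_p := U *m delta_mx i 0.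
have Uv : U^T *m v = delta_mx i 0 by rewrite /v mulmxA UU mul1mx.
have v0 : v != 0.
  apply: contra_eq_neq Uv => ->; rewrite mulmx0; apply/eqP => /matrixP /(_ i 0).
  by rewrite !mxE !eqxx => /eqP; rewrite eq_sym oner_eq0.
have := pX v v0.
rewrite ML; have -> : v^T *m (U *m diag_mx L *m U^T) *m v = (U^T *m v)^T *m (diag_mx L *m (U^T *m v)).
  by rewrite [(U^T *m v)^T]trmx_mul trmxK !mulmxA.
rewrite Uv trmx_delta mul_diag_mx mxE (bigD1 i)//= big1 ?addr0.
  by rewrite !mxE !eqxx mul1r mulr1.
by move=> k ki; rewrite !mxE (negPf ki) mul0r.
Qed.

Lemma invsqrt_gram_orthonormal {n p : nat} (X : 'M[R]_(n, p)) : posdefmx (X^T *m X) ->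
  (invsqrtmx (X^T *m X) *m X^T) *m (invsqrtmx (X^T *m X) *m X^T)^T = 1%:M.
Proof.
move=> /posdef_gram_spectral [U [L [UU XX -> L0]]].
rewrite trmx_mul trmxK tr_fcalc mulmxA -[_ *m X^T *m X]mulmxA XX !fcalcM//.
rewrite -(@fcalc_cst _ _ _ L UU) /fcalc.
congr (_ *m diag_mx _ *m _); apply/rowP => i; rewrite !mxE.
rewrite -{2}(sqr_sqrtr (ltW (L0 i))); field.
by rewrite gt_eqF// sqrtr_gt0.
Qed.

(* [H = (X^T X)^(1/2)] satisfies [(H + m) (H - m) = X^T X - m^2] and [H + m >= m]. *)
Lemma zstat_decomposition {n p : nat} (X : 'M[R]_(n, p)) (b : 'cV[R]_p) (e : 'cV[R]_n) (m : R) :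
  posdefmx (X^T *m X) -> 0 < m ->
  exists2 v : 'cV[R]_p,
    zstat (X *m b + e) X = m *: b + v + (invsqrtmx (X^T *m X) *m X^T) *m e &
    m ^+ 2 * \sum_j v j 0 ^+ 2 <= \sum_j (X^T *m X *m b - m ^+ 2 *: b) j 0 ^+ 2.
Proof.
move=> /posdef_gram_spectral [U [L [UU XX iE L0]]] m0.
exists (fcalc U L (fun x => Num.sqrt x - m) *m b).
  rewrite /zstat mulmxDr iE; congr (_ + _).
  rewrite mulmxA -[_ *m X^T *m X]mulmxA XX fcalcM//.
  rewrite -(fcalcB (fun x => Num.sqrt x) (fun=> m)) fcalc_cst// mulmxBl mul_scalar_mx addrC subrK.
  congr (_ *m _); rewrite /fcalc; congr (_ *m diag_mx _ *m _); apply/rowP => i; rewrite !mxE.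
  rewrite -[X in _ * X = _](sqr_sqrtr (ltW (L0 i))); field.
  by rewrite gt_eqF// sqrtr_gt0.
rewrite XX -mul_scalar_mx -(@fcalc_cst _ _ _ L UU) -mulmxBl fcalcB !fcalc_sqnorm// mulr_sumr.
apply: ler_sum => i _; rewrite mulrA ler_wpM2r ?sqr_ge0//.
have -> : id (L 0 i) - m ^+ 2 = (Num.sqrt (L 0 i) - m) * (Num.sqrt (L 0 i) + m).
  by rewrite -[X in X - _ = _](sqr_sqrtr (ltW (L0 i))); ring.
rewrite exprMn mulrC ler_wpM2l ?sqr_ge0// ler_sqr ?nnegrE ?addr_ge0 ?sqrtr_ge0 ?ltW//.
by rewrite ltrDr sqrtr_gt0.
Qed.

End invsqrt.

(** * Measurability of the inverse square root *)

Section newton_schulz.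
Context {R : realType}.

(** Newton's iteration for [y ^ (-2) = x] started at 1. It involves no division by [x] or [y], so
    its matrix version is a polynomial in the matrix. *)
Fixpoint newton_schulz (x : R) (k : nat) : R :=
  if k is k'.+1 then newton_schulz x k' * (3 - x * newton_schulz x k' ^+ 2) / 2 else 1.

Fixpoint newton_schulz_mx {p : nat} (A : 'M[R]_p) (k : nat) : 'M[R]_p :=
  if k is k'.+1 then
    2^-1 *: (newton_schulz_mx A k' *m
      (3%:M - A *m (newton_schulz_mx A k' *m newton_schulz_mx A k')))
  else 1%:M.

(* With [r = sqrt x * y], one step reads [1 - r' = (1 - r) ^ 2 * (2 + r) / 2]. *)
Lemma newton_schulz_bound (x : R) (k : nat) : 0 < x <= 1 ->
  let r := Num.sqrt x * newton_schulz x k in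
  Num.sqrt x <= r <= 1 /\ 1 - r <= (1 - Num.sqrt x / 2) ^+ k.
Proof.
move=> /andP[x0 x1]; have s0 : 0 < Num.sqrt x by rewrite sqrtr_gt0.
have s1 : Num.sqrt x <= 1 by rewrite -[leRHS](sqrtr1 R) ler_sqrt.
elim: k => [|k [/andP[IH1 IH2] IH3]] /=.
  rewrite mulr1 lexx s1; split => //; rewrite expr0; lra.
set s := Num.sqrt x in s0 s1 IH1 IH2 IH3 *.
set y := newton_schulz x k in IH1 IH2 IH3 *.
have xE : x = s ^+ 2 by rewrite /s sqr_sqrtr ?ltW.
have -> : s * (y * (3 - x * y ^+ 2) / 2) = (s * y) * (3 - (s * y) ^+ 2) / 2.
  by rewrite {1}xE; ring.
set r := s * y in IH1 IH2 IH3 *.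
have r0 : 0 < r by exact: lt_le_trans IH1.
have step : 1 - r * (3 - r ^+ 2) / 2 = (1 - r) * ((1 - r) * (2 + r) / 2) by field.
(* [(1 - r) * (2 + r) = 2 - r - r ^+ 2] decreases in [r >= s]; this gives a contraction factor that
   does not depend on [k]. *)
have q1 : (1 - r) * (2 + r) / 2 <= 1 - s / 2.
  have : (1 - r) * (2 + r) <= 2 - s by nra.
  lra.
split; [apply/andP; split|].
- have : 0 <= r * (1 - r ^+ 2) / 2; last by move=> ?; apply: (le_trans IH1); nra.
  by apply: divr_ge0 => //; apply: mulr_ge0; [exact: ltW|rewrite subr_ge0; nra].
- by rewrite -subr_ge0 step; apply: mulr_ge0; [lra|apply: divr_ge0 => //; apply: mulr_ge0; lra].
- rewrite step exprSr; apply: ler_pM => //; first lra.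
  by apply: divr_ge0 => //; apply: mulr_ge0; lra.
Qed.

Lemma newton_schulz_cvg (x : R) : 0 < x <= 1 ->
  newton_schulz x k @[k --> \oo] --> (Num.sqrt x)^-1.
Proof.
move=> x01; have s0 : 0 < Num.sqrt x by rewrite sqrtr_gt0; case/andP: x01.
have s1 : Num.sqrt x <= 1.
  by case/andP: x01 => ? ?; rewrite -[leRHS](sqrtr1 R) ler_sqrt.
have H : (Num.sqrt x * newton_schulz x k) @[k --> \oo] --> (1 : R).
  apply: (@squeeze_cvgr _ _ _ _ (fun k => 1 - (1 - Num.sqrt x / 2) ^+ k) (fun=> 1)).
  - apply: nearW => k; have [/andP[_ h1] h2] := newton_schulz_bound x k x01.
    by rewrite h1 andbT; lra.
  - rewrite -[X in _ --> X]subr0; apply: cvgB; first exact: cvg_cst.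
    apply: cvg_expr; rewrite ger0_norm; lra.
  - exact: cvg_cst.
have -> : newton_schulz x = (fun k => (Num.sqrt x)^-1 * (Num.sqrt x * newton_schulz x k)).
  by apply/funext => k; rewrite mulrA mulVf ?mul1r// gt_eqF.
rewrite -[X in _ --> X]mulr1; apply: cvgM => //; exact: cvg_cst.
Qed.

Lemma newton_schulz_fcalc {p : nat} (U : 'M[R]_p) (L : 'rV[R]_p) (t : R) (k : nat) :
  U^T *m U = 1%:M ->
  newton_schulz_mx (t *: fcalc U L id) k = fcalc U L (fun x => newton_schulz (t * x) k).
Proof.
move=> UU; elim: k => [|k IHk] /=; first by rewrite fcalc_cst.
rewrite IHk fcalcM// fcalcZ fcalcM// -(@fcalc_cst _ _ _ L UU) fcalcB fcalcM// fcalcZ.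
congr (_ *m diag_mx _ *m _); apply/rowP => i; rewrite !mxE /=; ring.
Qed.

Lemma cvg_sumr {I : Type} (s : seq I) (f : I -> nat -> R) (g : I -> R) :
  (forall i, f i m @[m --> \oo] --> g i) ->
  (\sum_(i <- s) f i m) @[m --> \oo] --> \sum_(i <- s) g i.
Proof.
move=> fg; elim: s => [|i s IHs].
  rewrite big_nil (_ : (fun m => _) = fun=> 0); first exact: cvg_cst.
  by apply/funext => m; rewrite big_nil.
rewrite big_cons (_ : (fun m => _) = fun m => f i m + \sum_(j <- s) f j m).
  exact: cvgD.
by apply/funext => m; rewrite big_cons.
Qed.

(** Dividing by the trace brings all eigenvalues into (0, 1], where the scalar iteration converges;
    the factor [Num.sqrt t] undoes the scaling. *)
Lemma invsqrt_gram_cvg {n p : nat} (X : 'M[R]_(n, p)) (i : 'I_p) (k : 'I_n) :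
  posdefmx (X^T *m X) ->
  let t := (\tr (X^T *m X))^-1 in
  (Num.sqrt t * (newton_schulz_mx (t *: (X^T *m X)) m *m X^T) i k) @[m --> \oo]
    --> (invsqrtmx (X^T *m X) *m X^T) i k.
Proof.
move=> pX; have [U [L [UU XX iE L0]]] := posdef_gram_spectral X pX.
rewrite iE /=; set t := _^-1.
have trE : \tr (X^T *m X) = \sum_j L 0 j.
  rewrite XX /fcalc mxtrace_mulC mulmxA UU mul1mx mxtrace_diag.
  by apply: eq_bigr => j _; rewrite mxE.
have tr0 : 0 < \tr (X^T *m X).
  rewrite trE (bigD1 i)//= ltr_pwDl// sumr_ge0// => j _; exact: ltW.
have t0 : 0 < t by rewrite invr_gt0.
have tL j : 0 < t * L 0 j <= 1.
  rewrite mulr_gt0//= /t mulrC ler_pdivrMr// mul1r trE (bigD1 j)//= lerDl.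
  by rewrite sumr_ge0// => l _; exact: ltW.
have E f : (fcalc U L f *m X^T) i k = \sum_l U i l * f (L 0 l) * (U^T *m X^T) l k.
  rewrite /fcalc -mulmxA mul_mx_diag mxE; apply: eq_bigr => l _.
  by rewrite !mxE.
rewrite E XX.
have -> : (fun m => Num.sqrt t * (newton_schulz_mx (t *: fcalc U L id) m *m X^T) i k)
  = (fun m => \sum_l U i l * (Num.sqrt t * newton_schulz (t * L 0 l) m) * (U^T *m X^T) l k).
  apply/funext => m; rewrite newton_schulz_fcalc// E mulr_sumr.
  by apply: eq_bigr => l _; ring.
apply: cvg_sumr => l; apply: cvgM; last exact: cvg_cst.
apply: cvgM; first exact: cvg_cst.
have -> : (Num.sqrt (L 0 l))^-1 = Num.sqrt t * (Num.sqrt (t * L 0 l))^-1.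
  rewrite sqrtrM ?ltW// invfM mulrA mulfV ?mul1r// gt_eqF// sqrtr_gt0//.
apply: cvgM; [exact: cvg_cst|exact: newton_schulz_cvg].
Qed.

End newton_schulz.

Section measurable_mx.
Context {R : realType} {d : measure_display} {T : measurableType d}.

Definition measurable_mx {m n : nat} (A : T -> 'M[R]_(m, n)) : Prop :=
  forall i j, measurable_fun setT (fun x => A x i j).

Lemma measurable_mx_cst {m n : nat} (A : 'M[R]_(m, n)) : measurable_mx (fun=> A).
Proof. by move=> i j; exact: measurable_cst. Qed.

Lemma measurable_mx_tr {m n : nat} (A : T -> 'M[R]_(m, n)) :
  measurable_mx A -> measurable_mx (fun x => (A x)^T).
Proof.
move=> mA i j; rewrite (_ : (fun x => _) = fun x => A x j i); first exact: mA.
by apply/funext => x; rewrite mxE.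
Qed.

Lemma measurable_mxM {m n p : nat} (A : T -> 'M[R]_(m, n)) (B : T -> 'M[R]_(n, p)) :
  measurable_mx A -> measurable_mx B -> measurable_mx (fun x => A x *m B x).
Proof.
move=> mA mB i j; rewrite (_ : (fun x => _) = fun x => \sum_k A x i k * B x k j).
  by apply: measurable_sum => k; exact: measurable_funM.
by apply/funext => x; rewrite mxE.
Qed.

Lemma measurable_mxB {m n : nat} (A B : T -> 'M[R]_(m, n)) :
  measurable_mx A -> measurable_mx B -> measurable_mx (fun x => A x - B x).
Proof.
move=> mA mB i j; rewrite (_ : (fun x => _) = fun x => A x i j - B x i j).
  exact: measurable_funB.
by apply/funext => x; rewrite !mxE.
Qed.

Lemma measurable_mxZ {m n : nat} (c : T -> R) (A : T -> 'M[R]_(m, n)) :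
  measurable_fun setT c -> measurable_mx A -> measurable_mx (fun x => c x *: A x).
Proof.
move=> mc mA i j; rewrite (_ : (fun x => _) = fun x => c x * A x i j).
  exact: measurable_funM.
by apply/funext => x; rewrite !mxE.
Qed.

Lemma measurable_newton_schulz {p : nat} (A : T -> 'M[R]_p) (k : nat) :
  measurable_mx A -> measurable_mx (fun x => newton_schulz_mx (A x) k).
Proof.
move=> mA; elim: k => [|k IHk] /=; first exact: measurable_mx_cst.
apply: measurable_mxZ => //; apply: measurable_mxM => //.
apply: measurable_mxB; first exact: measurable_mx_cst.
by apply: measurable_mxM => //; exact: measurable_mxM.
Qed.

(** [gauss_given_orthonormal] needs orthonormal rows at every point, while whitening provides them
    only almost surely. On the exceptional set the first [p] rows of the identity are used, which is
    where [p <= n] enters. *)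
Lemma measurable_orthonormal_extension {p n : nat} (V : T -> 'M[R]_(p, n)) :
  (p <= n)%N -> measurable_mx V ->
  exists W : T -> 'I_p -> 'I_n -> R,
  [/\ forall i k, measurable_fun setT (fun x => W x i k),
      forall x i i', \sum_k W x i k * W x i' k = (i == i')%:R &
      forall x, V x *m (V x)^T = 1%:M -> forall i k, W x i k = V x i k].
Proof.
move=> pn mV.
pose D := [set x | V x *m (V x)^T = 1%:M].
have mD : measurable D.
  have mVV : measurable_mx (fun x => V x *m (V x)^T).
    by apply: measurable_mxM => //; exact: measurable_mx_tr.
  have -> : D = \bigcap_(ij in [set: 'I_p * 'I_p])
      ((fun x => (V x *m (V x)^T) ij.1 ij.2) @^-1` [set ((1%:M : 'M[R]_p) ij.1 ij.2)]).
    apply/seteqP; split => x /=; rewrite /D /= => H; first by move=> ij _ /=; rewrite H.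
    by apply/matrixP => i j; exact: (H (i, j) I).
  apply: fin_bigcap_measurable; first exact: finite_finset.
  by move=> ij _; rewrite -[X in measurable X]setTI; exact: mVV.
pose W x i k : R := if `[< D x >] then V x i k else (i == k :> nat)%:R.
exists W; split.
- move=> i k; apply: measurable_fun_ifT; [|exact: mV|exact: measurable_cst].
  apply: (measurable_fun_bool true); rewrite setTI.
  by rewrite (_ : _ @^-1` _ = D)//; apply/seteqP; split => x /=; move=> /asboolP.
- move=> x i i'; rewrite /W; case: asboolP => [Dx|_].
    have := congr1 (fun A : 'M[R]_p => A i i') Dx; rewrite !mxE => <-.
    by apply: eq_bigr => k _; rewrite mxE.
  rewrite (bigD1 (widen_ord pn i))//= big1 ?addr0.
    by rewrite eqxx mul1r -val_eqE /= eq_sym.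
  move=> k /negPf ki; rewrite (_ : (i == k :> nat) = false) ?mul0r//.
  by rewrite eq_sym -ki.
- by move=> x Dx i k; rewrite /W; case: asboolP.
Qed.

(* [invsqrtmx] is built on a spectral decomposition picked by choice; its measurability comes
   from writing it as a limit of polynomials in the entries of [X]. *)
Lemma measurable_gram_whitening {n p : nat} (X : T -> 'M[R]_(n, p)) :
  (p <= n)%N -> measurable_mx X ->
  exists W : T -> 'I_p -> 'I_n -> R,
  [/\ forall i k, measurable_fun setT (fun x => W x i k),
      forall x i i', \sum_k W x i k * W x i' k = (i == i')%:R &
      forall x, posdefmx ((X x)^T *m X x) ->
        forall i k, W x i k = (invsqrtmx ((X x)^T *m X x) *m (X x)^T) i k].
Proof.
move=> pn mX.
pose t x := (\tr ((X x)^T *m X x))^-1.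
pose h m x i k := Num.sqrt (t x) *
  (newton_schulz_mx (t x *: ((X x)^T *m X x)) m *m (X x)^T) i k.
(* An upper limit is measurable whether or not the sequence converges, and it is the limit wherever
   the Gram matrix is positive definite. *)
pose V x : 'M[R]_(p, n) := \matrix_(i, k) fine (limn_esup (fun m => (h m x i k)%:E)).
have mG : measurable_mx (fun x => (X x)^T *m X x).
  by apply: measurable_mxM => //; exact: measurable_mx_tr.
have tr_ge0 x : 0 <= \tr ((X x)^T *m X x).
  by apply: sumr_ge0 => i _; rewrite mxE sumr_ge0// => k _; rewrite mxE -expr2 sqr_ge0.
have mtr : measurable_fun setT (fun x => \tr ((X x)^T *m X x)).
  by apply: measurable_sum => i; exact: mG.
have mt : measurable_fun setT t.
  rewrite (_ : t = fun x => (\tr ((X x)^T *m X x)) `^ (-1)).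
    exact: (measurableT_comp (@measurable_powR R (-1)) mtr).
  by apply/funext => x; rewrite powR_inv1.
have mst : measurable_fun setT (fun x => Num.sqrt (t x)).
  rewrite (_ : (fun x => _) = fun x => t x `^ (2^-1)).
    exact: (measurableT_comp (@measurable_powR R (2^-1)) mt).
  by apply/funext => x; rewrite powR12_sqrt// invr_ge0.
have mV : measurable_mx V.
  move=> i k; rewrite (_ : (fun x => _) = fine \o fun x => limn_esup (fun m => (h m x i k)%:E)); last first.
    by apply/funext => x; rewrite mxE.
  apply: measurableT_comp; first exact: fine_measurable.
  apply: (measurable_fun_limn_esup (f := fun m x => (h m x i k)%:E)) => m.
  apply/measurable_EFinP; apply: measurable_funM => //.
  apply: measurable_mxM; last exact: measurable_mx_tr.
  by apply: measurable_newton_schulz; exact: measurable_mxZ.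
have [W [mW WW WV]] := measurable_orthonormal_extension V pn mV.
exists W; split => // x pX i k.
have VE : V x = invsqrtmx ((X x)^T *m X x) *m (X x)^T.
  apply/matrixP => {}i {}k; rewrite mxE.
  have H := invsqrt_gram_cvg (X x) i k pX.
  have cv : (h m x i k)%:E @[m --> \oo] --> ((invsqrtmx ((X x)^T *m X x) *m (X x)^T) i k)%:E.
    by apply: cvg_EFin; [exact: nearW|].
  by rewrite is_cvg_limn_esupE; [rewrite (cvg_lim _ cv)|apply/cvg_ex; eexists; exact: cv].
by rewrite WV ?VE//; exact: invsqrt_gram_orthonormal.
Qed.

End measurable_mx.

(** * Lower bounds on the two error probabilities *)

Import HBNNSimple.

(* [f] need not be measurable: the integral of a nonnegative function is a lower integral. *)
Lemma ge1_integral_probability {R : realType} {d : measure_display} {Om : measurableType d}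
    (P : probability Om R) (f : Om -> R) (F : set Om) :
  (forall w, 0 <= f w) -> measurable F -> (forall w, F w -> 1 <= f w) ->
  (P F <= \int[P]_w (f w)%:E)%E.
Proof.
move=> f0 mF fF; rewrite ge0_integralTE; last by move=> w; rewrite lee_fin.
rewrite -(sintegral_indic P F).
apply: ereal_sup_ubound; exists (indic_nnsfun R mF) => //= w.
rewrite lee_fin -[leLHS]/(\1_F w) indicE; have [wF|wF] := boolP (w \in F); last exact: f0.
by apply: fF; exact: set_mem.
Qed.

(** The finite measures [P (A & F)] and [P A * P F], as functions of [A], agree on the pi-system
    [G], hence on the sigma-algebra that it generates. *)
Lemma indep_g_sigma {R : realType} {d : measure_display} {Om : measurableType d}
    (P : probability Om R) (G : set (set Om)) (F : set Om) :
  G `<=` measurable -> setI_closed G -> G setT -> measurable F ->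
  (forall A, G A -> P (A `&` F) = (P A * P F)%E) ->
  forall A, <<s G >> A -> P (A `&` F) = (P A * P F)%E.
Proof.
move=> Gm GI GT mF GF A sA.
have PF0 : 0 <= fine (P F) by rewrite fine_ge0.
pose m1 : measure Om R := mrestr P mF.
pose m2 : measure Om R := mscale (NngNum PF0) P.
have m2E B : m2 B = (P B * P F)%E.
  rewrite [LHS](_ : _ = ((fine (P F))%:E * P B)%E)// fineK ?fin_num_measure//.
  by rewrite muleC.
rewrite -m2E; apply: (g_sigma_algebra_measure_unique G Gm (fun=> setT) _ _ m1 m2) => //.
- by apply/seteqP; split => // w _; exists 0%N.
- by move=> B GB; rewrite m2E; exact: GF.
- by move=> _; rewrite /m1 /mrestr /= (le_lt_trans (probability_le1 _ _))// ?ltry// setTI.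
Qed.

Section design_sigma_algebra.
Context {R : realType} {d : measure_display} {Om : measurableType d}.
Variables (P : probability Om R) (n p : nat) (X : Om -> 'M[R]_(n, p)).
Hypothesis mX : forall i j, measurable_fun setT (fun w => X w i j).

Definition design_boxes : set (set Om) :=
  [set D | exists2 A : 'I_n -> 'I_p -> set R, (forall i j, measurable (A i j)) &
     D = [set w | forall i j, A i j (X w i j)]].

(** The sample space with the sigma-algebra generated by the entries of [X]. The design enters the
    Gaussian lemmas as the identity map into this space, so no measurable structure on matrices is
    required. *)
Definition design_space := g_sigma_algebraType design_boxes.

Lemma design_boxes_measurable : design_boxes `<=` measurable.
Proof.
move=> _ [A mA ->].
rewrite (_ : [set _ | _] = \bigcap_(ij in [set: 'I_n * 'I_p])
   ((fun w => X w ij.1 ij.2) @^-1` (A ij.1 ij.2))).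
  apply: fin_bigcap_measurable; first exact: finite_finset.
  by move=> ij _; rewrite -[X in measurable X]setTI; exact: mX.
by apply/seteqP; split => w /= H; [move=> ij _; exact: H|move=> i j; exact: (H (i, j) I)].
Qed.

Lemma design_boxes_setI_closed : setI_closed design_boxes.
Proof.
move=> _ _ [A mA ->] [B mB ->]; exists (fun i j => A i j `&` B i j).
  by move=> i j; exact: measurableI.
by apply/seteqP; split => w /= => [[HA HB] i j|H]; split => // i j; have [] := H i j.
Qed.

Lemma measurable_to_design_space : measurable_fun setT (id : Om -> design_space).
Proof.
move=> _ D mD; rewrite setTI preimage_id.
move: D mD; apply: smallest_sub; first exact: sigma_algebra_measurable.
exact: design_boxes_measurable.
Qed.

Lemma measurable_design : measurable_mx (X : design_space -> 'M[R]_(n, p)).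
Proof.
move=> i j _ B mB; rewrite setTI; apply: sub_gen_smallest.
exists (fun i' j' => if (i' == i) && (j' == j) then B else setT).
  by move=> i' j'; case: ifP.
apply/seteqP; split => w /=; last by move=> /(_ i j); rewrite !eqxx.
by move=> Bw i' j'; case: ifP => // /andP[/eqP -> /eqP ->].
Qed.

Lemma gauss_given_noise (eps : Om -> 'cV[R]_n) :
  std_gauss_vec P eps -> indep_design_noise P X eps ->
  gauss_given P (id : Om -> design_space) setT (fun w k => eps w k 0).
Proof.
move=> [me He] ind; split => // D B mD mB.
pose F := [set w | forall k, B k (eps w k 0)].
have mF : measurable F by exact: (measurable_box (fun w k => eps w k 0)).
have PF : P F = (\prod_(k < n) normal_prob 0 1 (B k))%E by exact: He.
rewrite setTI preimage_id -PF; apply: (indep_g_sigma P design_boxes) => //.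
- exact: design_boxes_measurable.
- exact: design_boxes_setI_closed.
- by exists (fun _ _ => setT) => //; apply/seteqP; split.
- by move=> _ [A mA ->]; exact: ind.
Qed.

End design_sigma_algebra.

Lemma measure_bigsetU_uniq {R : realType} {d : measure_display} {Om : measurableType d}
    (mu : measure Om R) {I : eqType} (s : seq I) (F : I -> set Om) :
  uniq s -> (forall i, measurable (F i)) ->
  (forall i j, i != j -> F i `&` F j = set0) ->
  mu (\big[setU/set0]_(i <- s) F i) = (\sum_(i <- s) mu (F i))%E.
Proof.
move=> + mF dF; elim: s => [|i s IHs] /=; first by rewrite !big_nil measure0.
move=> /andP[si us]; rewrite !big_cons measureU//.
- by congr (_ + _)%E; exact: IHs.
- exact: bigsetU_measurable.
- rewrite big_distrr /= big1_seq// => j /andP[_ js]; apply: dF.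
  by apply: contraNneq si => ->.
Qed.

Section model.
Context {R : realType} {d : measure_display} {Om : measurableType d}.
Variables (P : probability Om R) (n p : nat) (X : Om -> 'M[R]_(n, p)) (eps : Om -> 'cV[R]_n).
Hypothesis mX : forall i j, measurable_fun setT (fun w => X w i j).
Hypothesis pn : (p <= n)%N.
Hypothesis noise : std_gauss_vec P eps.
Hypothesis indep : indep_design_noise P X eps.
Hypothesis pdX : {ae P, forall w, posdefmx ((X w)^T *m X w)}.
Notation gam := (@normal_prob R 0 1).
Notation dspace := (design_space n p X).

(** [Z] and the null set [N] come before [b] and [m]: the same noise serves under the null and under
    every alternative. *)
Lemma whitened_noise : exists (Z : Om -> 'I_p -> R) (N : set Om),
  [/\ gauss_given P (id : Om -> dspace) setT Z, measurable N, P N = 0%E &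
   forall w, ~ N w -> forall b m, 0 < m -> exists2 v : 'I_p -> R,
     forall j, zstat (X w *m b + eps w) (X w) j 0 = m * b j 0 + v j + Z w j &
     m ^+ 2 * \sum_j v j ^+ 2 <=
       \sum_j ((X w)^T *m X w *m b - m ^+ 2 *: b) j 0 ^+ 2].
Proof.
have mid := measurable_to_design_space n p X mX.
have [W [mW WW WE]] := measurable_gram_whitening (X : dspace -> _) pn (measurable_design n p X).
have [N [mN PN NE]] := pdX.
exists (fun w i => \sum_k W w i k * eps w k 0), N; split => //.
  exact: (gauss_given_orthonormal P _ mid p n setT (fun w k => eps w k 0) W measurableT mW WW
    (gauss_given_noise P n p X mX eps noise indep)).
move=> w Nw b m m0.
have pX : posdefmx ((X w)^T *m X w).
  by apply: contrapT => H; apply: Nw; exact: NE.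
have [v zE vb] := zstat_decomposition (X w) b (eps w) m pX m0.
exists (fun j => v j 0) => // j.
rewrite zE !mxE; congr (_ + _); apply: eq_bigr => k _.
by rewrite WE// mxE.
Qed.

Let ae_inner (N F : set Om) : measurable N -> P N = 0%E -> measurable F ->
  P (F `\` N) = P F.
Proof.
move=> mN PN mF; rewrite measureD//; last by rewrite (le_lt_trans (probability_le1 P mF))// ltry.
have : (P (F `&` N) <= 0)%E by rewrite -PN le_measure// inE//; exact: measurableI.
by rewrite measure_le0 => /eqP ->; rewrite sube0.
Qed.

Let gauss_box (Z : Om -> 'I_p -> R) (B : 'I_p -> set R) :
  gauss_given P (id : Om -> dspace) setT Z -> (forall j, measurable (B j)) ->
  measurable [set w | forall j, B j (Z w j)] /\
  P [set w | forall j, B j (Z w j)] = (\prod_(j < p) fine (gam (B j)))%:E.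
Proof.
move=> [mZ HZ] mB; split; first exact: measurable_box.
have := HZ setT B measurableT mB.
rewrite preimage_setT !setTI probability_setT mul1e => ->.
rewrite -prodEFin; apply: eq_bigr => j _; rewrite fineK// fin_num_measure//.
exact: mB.
Qed.

(** The events that [S] is exactly the set of coordinates above [tau] are disjoint for distinct [S];
    summing over the sets of size [k] gives a binomial probability. *)
Lemma null_rejection_lb (t tau : R) (k : nat) : t < k%:R -> (k <= p)%N ->
  (('C(p, k)%:R * fine (gam [set z : R | tau < `|z|%R]) ^+ k *
    fine (gam [set z : R | `|z|%R <= tau]) ^+ (p - k))%:E
   <= Ebeta P X eps 0 (xi_test t tau))%E.
Proof.
move=> tk kp; have [Z [N [HZ mN PN NE]]] := whitened_noise.
pose Bo : set R := [set z | tau < `|z|]; pose Bi : set R := [set z | `|z| <= tau].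
have mBi : measurable Bi.
  rewrite -[X in measurable X]setTI.
  exact: (measurable_fun_le measurableT (@normr_measurable R setT) (measurable_cst tau)).
have BoE : Bo = ~` Bi.
  by apply/seteqP; split => z /=; rewrite /Bo /Bi /= ltNge => /negP.
have mBo : measurable Bo by rewrite BoE; exact: measurableC.
pose BS (S : {set 'I_p}) j := if j \in S then Bo else Bi.
have mBS S j : measurable (BS S j) by rewrite /BS; case: ifP.
pose FS S := [set w | forall j, BS S j (Z w j)].
have FSE S w : FS S w -> [set j | tau < `|Z w j|]%SET = S.
  move=> H; apply/setP => j; rewrite inE; have := H j; rewrite /BS.
  by case: ifP => // _; rewrite /Bi /= leNgt => /negbTE.
pose sS := enum [set S : {set 'I_p} | #|S| == k]%SET.
pose F := \big[setU/set0]_(S <- sS) FS S.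
have mFS S : measurable (FS S) by have [] := gauss_box Z (BS S) HZ (mBS S).
have mF : measurable F by exact: bigsetU_measurable.
have PF : P F = ('C(p, k)%:R * fine (gam Bo) ^+ k * fine (gam Bi) ^+ (p - k))%:E.
  rewrite measure_bigsetU_uniq ?enum_uniq//; last first.
    move=> S S' SS'; apply/seteqP; split => w // -[/FSE SE /FSE SE'].
    by move: SS'; rewrite -SE -SE' eqxx.
  rewrite big_enum /= (eq_bigr (fun=> (fine (gam Bo) ^+ k * fine (gam Bi) ^+ (p - k))%:E)); last first.
    move=> S; rewrite inE => /eqP Sk; have [_ ->] := gauss_box Z (BS S) HZ (mBS S).
    congr EFin; rewrite (bigID (mem S)) /=; congr (_ * _).
      rewrite (eq_bigr (fun=> fine (gam Bo))); last by move=> j jS; rewrite /BS jS.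
      by rewrite prodr_const Sk.
    rewrite (eq_bigr (fun=> fine (gam Bi))); last by move=> j jS; rewrite /BS (negbTE jS).
    rewrite (eq_bigl (mem (~: S))); last by move=> j; rewrite !inE.
    by rewrite prodr_const cardsCs finset.setCK card_ord Sk.
  rewrite sumEFin; congr EFin.
  by rewrite sumr_const card_draws card_ord -mulrA mulr_natl.
rewrite -PF -(ae_inner N F mN PN mF).
apply: ge1_integral_probability.
- by move=> w; rewrite /xi_test; case: ifP.
- exact: measurableD.
- move=> w [Fw Nw]; rewrite /xi_test.
  have [v zE vb] := NE w Nw 0 1 ltr01.
  (* At [b = 0] the right-hand side of the bound on the shift is zero, so [z] is exactly the
     whitened noise. *)
  have v0 j : v j = 0.
    move: vb; rewrite mulmx0 scaler0 subr0 [leRHS]big1; last by move=> i _; rewrite mxE expr0n.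
    rewrite expr1n mul1r => vle.
    have : \sum_j v j ^+ 2 == 0.
      by rewrite eq_le vle sumr_ge0// => i _; exact: sqr_ge0.
    rewrite psumr_eq0; last by move=> i _; exact: sqr_ge0.
    by move=> /allP /(_ j (mem_index_enum j)); rewrite sqrf_eq0 => /eqP.
  have -> : Tstat tau (X w *m 0 + eps w) (X w) = k.
    move: Fw; rewrite /F -bigcup_seq => -[S]; rewrite /= mem_enum inE => /eqP Sk /FSE SE.
    rewrite -Sk -SE /Tstat; apply: eq_card => j; rewrite !inE.
    have zZ : zstat (X w *m 0 + eps w) (X w) j 0 = Z w j.
      by rewrite zE mxE mulr0 v0 !add0r.
    by apply/idP/idP => [/set_mem /=|H]; [|apply/mem_set => /=]; rewrite zZ.
  by rewrite tk.
Qed.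

(** By the bound in [whitened_noise], this event forces the shift [v] to have Euclidean norm at most
    1. *)
Definition good_design (b : 'cV[R]_p) (m : R) : set Om :=
  [set w | \sum_j ((X w)^T *m X w *m b - m ^+ 2 *: b) j 0 ^+ 2 <= m ^+ 2].

Lemma measurable_good_design (b : 'cV[R]_p) (m : R) :
  measurable (good_design b m : set dspace).
Proof.
have mD := measurable_design n p X.
have mV : measurable_mx (fun w : dspace => (X w)^T *m X w *m b - m ^+ 2 *: b).
  apply: measurable_mxB; last exact: measurable_mx_cst.
  apply: measurable_mxM; last exact: measurable_mx_cst.
  by apply: measurable_mxM => //; exact: measurable_mx_tr.
rewrite -[X in measurable X]setTI; apply: measurable_fun_le => //.
by apply: measurable_sum => j; apply: measurable_funX; exact: mV.
Qed.

(** The first [k] coordinates are left free, the other [s - k] signals have their noise confined to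
    a unit interval, and the nulls stay below [tau - 1]. The margin 1 pays for the shift, each entry
    of which is at most 1 on the good event; that event depends on the design only, hence the
    product. *)
Lemma alternative_acceptance_lb (t tau x m A : R) (k s : nat) :
  let b : 'cV[R]_p := \col_j (if (j < s)%N then A else 0) in
  0 < m -> (k <= s)%N -> (s <= p)%N -> k%:R <= t ->
  (forall z, x <= z <= x + 1 -> `|z + m * A| <= tau - 1) ->
  ((fine (P (good_design b m)) * fine (gam `[x, (x + 1)]) ^+ (s - k) *
    fine (gam [set z : R | `|z|%R <= tau - 1]) ^+ (p - s))%:E
   <= Ebeta P X eps b (fun y X => (1 - xi_test t tau y X)%R))%E.
Proof.
move=> b m0 ks sp kt xB; have [Z [N [HZ mN PN NE]]] := whitened_noise.
pose Bi : set R := [set z | `|z| <= tau - 1].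
have mBi : measurable Bi.
  rewrite -[X in measurable X]setTI.
  exact: (measurable_fun_le measurableT (@normr_measurable R setT) (measurable_cst _)).
pose B (j : 'I_p) : set R :=
  if (j < k)%N then setT else if (j < s)%N then `[x, x + 1]%classic else Bi.
have mB j : measurable (B j) by rewrite /B; case: ifP => // _; case: ifP.
pose G := good_design b m.
have mGd : measurable (G : set dspace) by exact: measurable_good_design.
have mG : measurable G.
  by have := measurable_to_design_space n p X mX measurableT _ mGd; rewrite setTI.
pose F := G `&` [set w | forall j, B j (Z w j)].
have [mbox Pbox] := gauss_box Z B HZ mB.
have mF : measurable F by exact: measurableI.
have prodE : \prod_(j < p) fine (gam (B j)) = fine (gam `[x, (x + 1)]) ^+ (s - k) * fine (gam Bi) ^+ (p - s).
  pose g j : R := if (j < k)%N then 1 else if (j < s)%N then fine (gam `[x, (x + 1)]) else fine (gam Bi).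
  rewrite (eq_bigr (fun j : 'I_p => g j)); last first.
    move=> j _; rewrite /g /B; case: ifP => [_|_]; last by case: ifP.
    by rewrite [X in fine X](probability_setT gam).
  rewrite -(big_mkord xpredT g) (big_cat_nat (leq0n k) (leq_trans ks sp))//=.
  rewrite big_nat big1 ?mul1r; last by move=> j /andP[_ jk]; rewrite /g jk.
  rewrite (big_cat_nat ks sp)/=; congr (_ * _).
    rewrite big_nat (eq_bigr (fun=> fine (gam `[x, (x + 1)]))).
      by rewrite -big_nat prodr_const_nat.
    by move=> j /andP[kj js]; rewrite /g ltnNge kj /= js.
  rewrite big_nat (eq_bigr (fun=> fine (gam Bi))).
    by rewrite -big_nat prodr_const_nat.
  by move=> j /andP[sj jp]; rewrite /g !ltnNge sj (leq_trans ks sj).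
have PF : P F = (fine (P G) * fine (gam `[x, (x + 1)]) ^+ (s - k) * fine (gam Bi) ^+ (p - s))%:E.
  have [_ HZ2] := HZ; have := HZ2 G B mGd mB; rewrite setTI preimage_id => ->.
  rewrite -mulrA -prodE EFinM -prodEFin fineK ?fin_num_measure//; congr (_ * _)%E.
  by apply: eq_bigr => j _; rewrite fineK// fin_num_measure//; exact: mB.
rewrite -PF -(ae_inner N F mN PN mF).
apply: ge1_integral_probability.
- by move=> w; rewrite /xi_test; case: ifP => _; rewrite ?subrr ?subr0.
- exact: measurableD.
- move=> w [[Gw Bw] Nw]; rewrite /xi_test.
  have [v zE vb] := NE w Nw b m m0.
  have v1 j : `|v j| <= 1.
    have : \sum_i v i ^+ 2 <= 1.
      have := le_trans vb Gw; rewrite -[leRHS]mulr1 ler_pM2l// exprn_gt0//.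
    rewrite (bigD1 j)//= => H; rewrite -(@expr_le1 _ 2)// real_normK ?num_real//.
    by apply: le_trans H; rewrite lerDl sumr_ge0// => i _; exact: sqr_ge0.
  rewrite ltNge (_ : _ <= t) ?subr0//; apply: le_trans kt; rewrite ler_nat.
  have kp := leq_trans ks sp.
  (* Every coordinate above [tau] is one of the first [k], so their number is at most [k <= t]. *)
  rewrite /Tstat; apply: (@leq_trans #|codom (widen_ord kp)|); last first.
    by apply: (leq_trans (leq_image_card _ _)); rewrite card_ord.
  apply: subset_leq_card; apply/fintype.subsetP => j /set_mem /= zj.
  have [jk|kj] := ltnP j k.
    by apply/codomP; exists (Ordinal jk); exact/val_inj.
  suff : `|zstat (X w *m b + eps w) (X w) j 0| <= tau by rewrite leNgt zj.
  rewrite zE; have := Bw j; rewrite /B ltnNge kj /=; have := v1 j; rewrite /b mxE.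
  case: ifP => js vj.
    rewrite /= in_itv /= => /xB H.
    rewrite (_ : _ + _ = v j + (Z w j + m * A)); last by ring.
    by apply: (le_trans (ler_normD _ _)); lra.
  rewrite /Bi /= => H; rewrite mulr0 add0r.
  by apply: (le_trans (ler_normD _ _)); lra.
Qed.

End model.

(** * Gaussian tail bounds *)

Section gauss_tails.
Context {R : realType}.
Notation mu := (@lebesgue_measure R).
Notation gam := (@normal_prob R 0 1).
Notation rT := (measurableTypeR R).

Lemma normal_prob_unit_itv_ge (x K : R) : `|x| <= K -> `|x + 1| <= K ->
  normal_peak 1 * expR (- (K ^+ 2 / 2)) <= fine (gam `[x, x + 1]).
Proof.
move=> xK x1K; rewrite -lee_fin fineK; last by rewrite fin_num_measure.
rewrite /normal_prob.
have -> : (normal_peak 1 * expR (- (K ^+ 2 / 2)))%:E =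
    (\int[mu]_(y in `[x, (x + 1)%R]) (normal_peak 1 * expR (- (K ^+ 2 / 2)))%:E)%E.
  rewrite integral_cst//= lebesgue_measure_itv /= lte_fin ltrDl ltr01.
  by rewrite -EFinD addrAC subrr add0r mule1.
apply: ge0_le_integral => //=.
- by move=> y _; rewrite lee_fin mulr_ge0 ?expR_ge0// ?normal_peak_ge0.
- by apply/measurable_EFinP/measurable_funTS; exact: measurable_normal_pdf.
- move=> y; rewrite in_itv /= => /andP[xy yx1].
  rewrite lee_fin normal_pdf01E ler_wpM2l ?normal_peak_ge0// ler_expR lerN2.
  rewrite ler_wpM2r ?invr_ge0//; move: xK x1K; rewrite !ler_norml => /andP[? ?] /andP[? ?].
  nra.
Qed.

Lemma normal_prob_gt_le (u : R) : 0 <= u ->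
  (gam [set z : R | u < z]%R <= (expR (- (u ^+ 2 / 2)))%:E)%E.
Proof.
move=> u0; set B := [set z : R | u < z]%R.
have mB : measurable (B : set rT).
  by rewrite (_ : B = `]u, +oo[%classic)//; apply/seteqP; split => z; rewrite /B /= in_itv /= andbT.
have mpdf : measurable_fun setT (fun z : rT => (normal_pdf 0 1 z)%:E).
  by apply/measurable_EFinP; exact: measurable_normal_pdf.
have mI (C : set rT) : measurable C -> measurable_fun setT (fun z : rT => (\1_C z : R)%:E).
  by move=> mC; apply/measurable_EFinP; exact: measurable_indic.
have E : gam B = (\int[mu]_z ((\1_B z : R)%:E * (normal_pdf 0 1 z)%:E))%E.
  rewrite /normal_prob integral_mkcond; apply: eq_integral => z _.
  rewrite patchE indicE; case: ifP => _; first by rewrite mul1e.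
  by rewrite mul0e.
rewrite E.
have mf : measurable_fun setT (fun z : rT => ((\1_B z : R)%:E * (normal_pdf 0 1 z)%:E)%E).
  by apply: emeasurable_funM => //; exact: mI.
rewrite -(ge0_integral_translate u (fun z => ((\1_B z : R)%:E * (normal_pdf 0 1 z)%:E)%E) mf); last first.
  by move=> z; rewrite mule_ge0// lee_fin// normal_pdf_ge0.
have mpe : measurable_fun setT (fun z : rT => ((expR (- (u ^+ 2 / 2)))%:E * (normal_pdf 0 1 z)%:E)%E).
  by apply: emeasurable_funM => //; exact: measurable_cst.
have mfu : measurable_fun setT (fun z : rT => ((\1_B (z + u)%R : R)%:E * (normal_pdf 0 1 (z + u)%R)%:E)%E).
  apply: (measurableT_comp mf).
  by apply: (@measurable_funD _ _ _ setT (fun z : R => z) (fun=> u)).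
apply: (@le_trans _ _ (\int[mu]_z ((expR (- (u ^+ 2 / 2)))%:E * (normal_pdf 0 1 z)%:E))%E).
  apply: ge0_le_integral => //.
  - by move=> z _; rewrite mule_ge0// lee_fin// normal_pdf_ge0.
  - move=> z _; rewrite indicE; have [zB|_] := boolP (_ \in B); last first.
      by rewrite mul0e mule_ge0// lee_fin ?expR_ge0 ?normal_pdf_ge0.
    move/set_mem : zB; rewrite /B /= ltrDr => z0.
    rewrite mul1e -EFinM lee_fin !normal_pdf01E mulrCA ler_wpM2l ?normal_peak_ge0//.
    rewrite -expRD ler_expR.
    have : 0 <= z * u by rewrite mulr_ge0// ltW.
    have -> : (z + u) ^+ 2 = z ^+ 2 + u ^+ 2 + 2 * (z * u) by ring.
    lra.
rewrite ge0_integralZl ?integral_normal_pdf ?mule1// ?lee_fin ?expR_ge0//.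
by move=> z _; rewrite lee_fin normal_pdf_ge0.
Qed.

Lemma normal_prob_norm_le_ge (u : R) : 0 <= u ->
  1 - 2 * expR (- (u ^+ 2 / 2)) <= fine (gam [set z : R | `|z| <= u]%R).
Proof.
move=> u0; set B := [set z : R | `|z| <= u]%R.
pose Bp : set R := [set z : R | u < z]%R.
have mBp : measurable (Bp : set rT).
  by rewrite (_ : Bp = `]u, +oo[%classic)//; apply/seteqP; split => z; rewrite /Bp /= in_itv /= andbT.
have mBn : measurable (-%R @^-1` Bp : set rT).
  by rewrite -[X in measurable X]setTI; exact: (@oppr_measurable R setT measurableT).
have mU : measurable (Bp `|` (-%R @^-1` Bp) : set rT) by exact: measurableU.
have BE : B = ~` (Bp `|` (-%R @^-1` Bp)).
  rewrite setCU; apply/seteqP; split => z /=; rewrite /B /Bp /= ler_norml.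
    move=> /andP[h1 h2]; split; apply/negP; rewrite -leNgt//.
    by rewrite lerNl.
  by move=> [/negP h1 /negP h2]; move: h1 h2; rewrite -!leNgt => -> h2; rewrite lerNl h2.
rewrite BE probability_setC; last exact: mU.
have Ufin : gam (Bp `|` (-%R @^-1` Bp)) \is a fin_num by exact: fin_num_measure.
rewrite fineB//= lerD2l lerN2 -lee_fin fineK//.
apply: (le_trans (measureU2 gam mBp mBn)).
have H := normal_prob_gt_le u u0.
rewrite mulr_natl mulr2n EFinD; apply: leeD; first exact: H.
by apply: le_trans H; rewrite -(normal_prob_sym Bp mBp).
Qed.

End gauss_tails.

(** * Concentration of the Gram matrix of a sub-Gaussian design *)

Section square_integrable.
Context {R : realType} {d : measure_display} {Om : measurableType d}.
Variable P : probability Om R.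
Notation L1 f := (P.-integrable setT (EFin \o f)).
Notation rT := (measurableTypeR R).

Lemma integrable_dominated (f g : Om -> R) : measurable_fun setT f ->
  (forall w, `|f w| <= g w) -> L1 g -> L1 f.
Proof.
move=> mf fg; apply: le_integrable => //; first exact/measurable_EFinP.
by move=> w _ /=; rewrite lee_fin (le_trans (fg w))// ler_norm.
Qed.

Lemma integrable_sumr {I : Type} (s : seq I) (f : I -> Om -> R) :
  (forall i, L1 (f i)) -> L1 (fun w => \sum_(i <- s) f i w).
Proof.
move=> Lf; elim: s => [|i s IHs].
  rewrite (_ : EFin \o _ = cst 0%E); last by apply/funext => w /=; rewrite big_nil.
  exact: integrable0.
rewrite (_ : EFin \o _ = ((EFin \o f i) \+ (EFin \o (fun w => (\sum_(i <- s) f i w)%R)))%E).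
  exact: integrableD.
by apply/funext => w /=; rewrite big_cons EFinD.
Qed.

Lemma Rintegral_sumr {I : Type} (s : seq I) (f : I -> Om -> R) :
  (forall i, L1 (f i)) ->
  \int[P]_w (\sum_(i <- s) f i w) = \sum_(i <- s) \int[P]_w f i w.
Proof.
move=> Lf; elim: s => [|i s IHs].
  rewrite big_nil (_ : (fun w => _) = fun=> 0); last by apply/funext => w; rewrite big_nil.
  by rewrite /Rintegral integral0.
rewrite big_cons -IHs -RintegralD//; last exact: integrable_sumr.
by congr (Rintegral _ _ _); apply/funext => w; rewrite big_cons.
Qed.

Lemma integrableZr (c : R) (f : Om -> R) : L1 f -> L1 (fun w => c * f w).
Proof.
by move=> Lf; rewrite (_ : EFin \o _ = fun w => (c%:E * (f w)%:E)%E) ?integrableZl.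
Qed.

Lemma integrable_addr (f g : Om -> R) : L1 f -> L1 g -> L1 (fun w => f w + g w).
Proof. by move=> Lf Lg; exact: (integrableD measurableT Lf Lg). Qed.

Lemma Rintegral_probability_cst (c : R) : \int[P]_w c = c.
Proof. by rewrite Rintegral_cst//= probability_setT mulr1. Qed.

Definition sqint (f : Om -> R) := measurable_fun setT f /\ L1 (fun w => f w ^+ 2).

Lemma sqint_cst (c : R) : sqint (fun=> c).
Proof.
split => //; apply/integrableP; split; first exact/measurable_EFinP.
by rewrite integral_cst//= probability_setT mule1 ltry.
Qed.

Lemma integrableM_sqint (f g : Om -> R) : sqint f -> sqint g -> L1 (fun w => f w * g w).
Proof.
move=> [mf Lf] [mg Lg].
apply: (integrable_dominated _ (fun w => f w ^+ 2 + g w ^+ 2)); first exact: measurable_funM.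
  move=> w; rewrite ler_norml; have := sqr_ge0 (f w + g w); have := sqr_ge0 (f w - g w).
  have := sqr_ge0 (f w); have := sqr_ge0 (g w).
  by move=> ? ? ? ?; apply/andP; split; nra.
exact: integrable_addr.
Qed.

Lemma integrable_sqint (f : Om -> R) : sqint f -> L1 f.
Proof.
move=> sf; have := integrableM_sqint _ _ sf (sqint_cst 1).
by under eq_fun do rewrite mulr1.
Qed.

Lemma sqintD (f g : Om -> R) : sqint f -> sqint g -> sqint (fun w => f w + g w).
Proof.
move=> sf sg; have Lfg := integrableM_sqint _ _ sf sg.
move: sf sg => [mf Lf] [mg Lg]; split; first exact: measurable_funD.
rewrite (_ : (fun w => _) = fun w => (f w ^+ 2 + 2 * (f w * g w)) + g w ^+ 2); last first.
  by apply/funext => w; ring.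
by apply: integrable_addr => //; apply: integrable_addr => //; exact: integrableZr.
Qed.

(** Fubini for the product law of [(f, g)]: the inner integral over the centered factor [g]
    vanishes. *)
Lemma Rintegral_mul_indep (f g : Om -> R) : sqint f -> sqint g ->
  (forall A B, measurable A -> measurable B ->
    P (f @^-1` A `&` g @^-1` B) = (P (f @^-1` A) * P (g @^-1` B))%E) ->
  \int[P]_w g w = 0 -> \int[P]_w (f w * g w) = 0.
Proof.
move=> sf sg fg g0; have Lfg := integrableM_sqint _ _ sf sg.
have Lg := integrable_sqint _ sg.
case: sf sg => [mf _] [mg _].
pose m1 := restr_law P measurableT (mf : measurable_fun setT (f : Om -> rT)).
pose m2 := restr_law P measurableT (mg : measurable_fun setT (g : Om -> rT)).
have joint : forall S : set (rT * rT), measurable S ->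
    P (setT `&` [set w | S (f w, g w)]) = ((m1 \x m2) S)%E.
  apply: (joint_law P setT measurableT (f : Om -> rT) (g : Om -> rT) mf mg m1 m2) => A B mA mB.
  by rewrite setTI fg//; congr (P _ * P _)%E; rewrite setTI.
have mh : measurable_fun setT (fun w => (f w : rT, g w : rT)) by exact: measurable_fun_pair.
pose h w := (f w : rT, g w : rT).
pose F (z : rT * rT) := (z.1 * z.2)%:E.
have mF : measurable_fun setT F.
  apply/measurable_EFinP; apply: measurable_funM.
    exact: measurable_fst.
  exact: measurable_snd.
have pE (k : rT * rT -> \bar R) : (\int[(m1 \x m2)%E]_z k z = \int[pushforward P h]_z k z)%E.
  by apply: eq_measure_integral => S mS _; rewrite -[LHS](joint S mS) setTI.
have iF : (m1 \x m2)%E.-integrable setT F.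
  apply/integrableP; split => //.
  rewrite pE ge0_integral_pushforward//; last exact: measurableT_comp.
  by rewrite preimage_setT; have /integrableP[_] := Lfg.
have E : (\int[P]_w (f w * g w)%:E = 0)%E.
  transitivity (\int[pushforward P h]_z F z)%E.
    by rewrite (integral_pushforward mh mF)// preimage_setT.
  rewrite -pE -integral12_prod_meas1//; apply: integral0_eq => x _.
  rewrite /fubini_F /F /=.
  have m2E (k : rT -> \bar R) : (\int[m2]_y k y = \int[pushforward P (g : Om -> rT)]_y k y)%E.
    by apply: eq_measure_integral => S mS _; rewrite -[LHS]/(P _) setTI.
  have iy : m2.-integrable setT (fun y : rT => y%:E).
    apply/integrableP; split; first exact/measurable_EFinP.
    rewrite m2E ge0_integral_pushforward//; last by apply: measurableT_comp => //; exact/measurable_EFinP.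
    by rewrite preimage_setT; have /integrableP[_] := Lg.
  under eq_integral do rewrite EFinM.
  have mE : measurable_fun setT (EFin : rT -> \bar R) by apply/measurable_EFinP; exact: measurable_id.
  have gE : (\int[pushforward P (g : Om -> rT)]_y y%:E = \int[P]_w (g w)%:E)%E.
    have mg' : measurable_fun setT (g : Om -> rT) := mg.
    have Lg' : P.-integrable ((g : Om -> rT) @^-1` setT) ((EFin : rT -> \bar R) \o (g : Om -> rT)).
      by rewrite preimage_setT.
    by apply: etrans (integral_pushforward mg' mE Lg' measurableT) _; rewrite preimage_setT.
  rewrite integralZl// m2E gE.
  rewrite -[X in (_ * X)%E]fineK; last exact: integrable_fin_num.
  by rewrite -[fine _]/(\int[P]_w g w) g0 mule0.
by rewrite /Rintegral E.
Qed.

End square_integrable.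

(** The Taylor term of order 4, with [24 = 4!]. Both signs appear so that a fourth moment is
    controlled by the moment generating function at 1 and -1; the later constant 48 counts the
    two. *)
Lemma quartic_le_expR {R : realType} (x : R) : x ^+ 4 <= 24 * (expR x + expR (- x)).
Proof.
have pos (y : R) : 0 <= y -> y ^+ 4 <= 24 * expR y.
  move=> y0; have := @expR_ge1Dxn R y 3 y0.
  rewrite (_ : (4`!)%:R = 24)// => H.
  have : y ^+ 4 / 24 <= expR y by lra.
  by rewrite ler_pdivrMr// mulrC.
have [x0|x0] := leP 0 x.
  by apply: (le_trans (pos _ x0)); rewrite ler_pM2l// lerDl expR_ge0.
have -> : x ^+ 4 = (- x) ^+ 4 by ring.
apply: (le_trans (pos (- x) _)); first by rewrite oppr_ge0 ltW.
by rewrite ler_pM2l// lerDr expR_ge0.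
Qed.

Section subG.
Context {R : realType} {d : measure_display} {Om : measurableType d}.
Variables (P : probability Om R).
Notation L1 f := (P.-integrable setT (EFin \o f)).
Notation sqint := (sqint P).

Lemma sqint_sqr_of_expR (f : Om -> R) (C : R) : measurable_fun setT f ->
  (\int[P]_w (expR (f w))%:E <= C%:E)%E -> (\int[P]_w (expR (- f w))%:E <= C%:E)%E ->
  sqint (fun w => f w ^+ 2) /\ \int[P]_w (f w ^+ 2) ^+ 2 <= 48 * C.
Proof.
move=> mf H1 H2.
have me : measurable_fun setT (fun w => expR (f w)) by exact: measurableT_comp.
have men : measurable_fun setT (fun w => expR (- f w)).
  by apply: measurableT_comp => //; exact: measurable_funN.
have Le : L1 (fun w => expR (f w)).
  apply/integrableP; split; first exact/measurable_EFinP.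
  apply: le_lt_trans (ltry C); apply: le_trans H1.
  by under eq_integral do rewrite /= ger0_norm ?expR_ge0//.
have Len : L1 (fun w => expR (- f w)).
  apply/integrableP; split; first exact/measurable_EFinP.
  apply: le_lt_trans (ltry C); apply: le_trans H2.
  by under eq_integral do rewrite /= ger0_norm ?expR_ge0//.
pose g w := 24 * (expR (f w) + expR (- f w)).
have Lg : L1 g by apply: integrableZr; exact: integrable_addr.
have f4 w : (f w ^+ 2) ^+ 2 <= g w by rewrite -exprM; exact: quartic_le_expR.
have m4 : measurable_fun setT (fun w => (f w ^+ 2) ^+ 2) by do 2 apply: measurable_funX.
have L4 : L1 (fun w => (f w ^+ 2) ^+ 2).
  apply: (integrable_dominated P _ g) => // w; rewrite ger0_norm// sqr_ge0//.
split; first by split => //; exact: measurable_funX.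
apply: (@le_trans _ _ (\int[P]_w g w)).
  by apply: le_Rintegral.
have -> : \int[P]_w g w = 24 * (\int[P]_w expR (f w) + \int[P]_w expR (- f w)).
  rewrite RintegralZl//; last exact: integrable_addr.
  by rewrite RintegralD.
have h1 : \int[P]_w expR (f w) <= C.
  by rewrite -lee_fin /Rintegral fineK//; exact: integrable_fin_num.
have h2 : \int[P]_w expR (- f w) <= C.
  by rewrite -lee_fin /Rintegral fineK//; exact: integrable_fin_num.
lra.
Qed.

Variables (n p : nat) (sigma2 : R) (X : Om -> 'M[R]_(n, p)).
Hypothesis SX : SubG P sigma2 X.

Let mX : forall i j, measurable_fun setT (fun w => X w i j).
Proof. by case: SX. Qed.

(** Independence is given for boxes; the pi-system argument is applied to one row and then to the
    other. *)
Lemma subG_row_indep (i i' : 'I_n) (D : set (design_space 1 p (fun w => row i (X w))))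
    (D' : set (design_space 1 p (fun w => row i' (X w)))) : i != i' ->
  measurable D -> measurable D' -> P (D `&` D') = (P D * P D')%E.
Proof.
move=> ii'.
have mrow k : forall a j, measurable_fun setT (fun w => row k (X w) a j).
  move=> a j; rewrite (_ : (fun w => _) = fun w => X w k j)//.
  by apply/funext => w; rewrite mxE.
have boxE k (A : 'I_1 -> 'I_p -> set R) :
    [set w | forall a j, A a j (row k (X w) a j)] = [set w | forall j, A 0 j (X w k j)].
  apply/seteqP; split => w /= H; first by move=> j; have := H 0 j; rewrite mxE.
  by move=> a j; rewrite ord1 mxE.
have step1 A B : design_boxes 1 p (fun w => row i (X w)) A ->
    design_boxes 1 p (fun w => row i' (X w)) B -> P (A `&` B) = (P A * P B)%E.
  move=> [A' mA ->] [B' mB ->]; rewrite !boxE.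
  pose C k j := if k == i then A' 0 j else if k == i' then B' 0 j else setT.
  have mC k j : measurable (C k j) by rewrite /C; case: ifP => // _; case: ifP.
  have [_ [H _]] := SX; have := H C mC.
  have i'i : (i' == i) = false by rewrite eq_sym; exact: negbTE.
  rewrite (bigD1 i)//= (bigD1 i') 1?eq_sym//= big1 ?mule1; last first.
    move=> k /andP[/negPf ki /negPf ki']; rewrite /C ki ki'.
    by rewrite (_ : [set _ | _] = setT) ?probability_setT//; apply/seteqP; split.
  rewrite {2 3}/C eqxx i'i eqxx => <-; congr (P _).
  apply/seteqP; split => w /=.
    move=> [HA HB] k j; rewrite /C; case: eqP => [->//|_]; by case: eqP => [->//|].
  move=> HC; split => j; first by have := HC i j; rewrite /C eqxx.
  by have := HC i' j; rewrite /C i'i eqxx.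
move=> mD mD'.
have dT k : design_boxes 1 p (fun w => row k (X w)) setT.
  by exists (fun _ _ => setT) => //; apply/seteqP; split.
have mD'Om : measurable (D' : set Om).
  by have := measurable_to_design_space 1 p _ (mrow i') measurableT _ mD'; rewrite setTI.
apply: (indep_g_sigma P (design_boxes 1 p (fun w => row i (X w)))) => //.
- exact: design_boxes_measurable.
- exact: design_boxes_setI_closed.
- move=> A GA; rewrite setIC muleC.
  apply: (indep_g_sigma P (design_boxes 1 p (fun w => row i' (X w)))) => //.
  + exact: design_boxes_measurable.
  + exact: design_boxes_setI_closed.
  + exact: (design_boxes_measurable _ _ _ (mrow i)).
  + by move=> B GB; rewrite setIC muleC; exact: step1.
Qed.

Let K := 48 * expR (sigma2 / 2).

Lemma subG_quartic (i : 'I_n) (u : 'cV[R]_p) (f : Om -> R) : \sum_j u j 0 ^+ 2 = 1 ->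
  (forall w, f w = \sum_k u k 0 * X w i k) ->
  sqint (fun w => f w ^+ 2) /\ \int[P]_w (f w ^+ 2) ^+ 2 <= K.
Proof.
move=> u1 fE; have [_ [_ [_ [_ [_ [H _]]]]]] := SX.
have -> : f = fun w => \sum_k u k 0 * X w i k by exact/funext.
apply: sqint_sqr_of_expR.
- by apply: measurable_sum => k; exact: measurable_funM.
- have := H i u 1 u1; rewrite expr1n mulr1 => H1; apply: le_trans H1.
  by under [leRHS]eq_integral do rewrite mul1r.
- have := H i u (-1) u1; rewrite sqrrN expr1n mulr1 => H1; apply: le_trans H1.
  by under [leRHS]eq_integral do rewrite mulN1r.
Qed.

Lemma subG_entry_quartic (i : 'I_n) (j : 'I_p) :
  sqint (fun w => X w i j ^+ 2) /\ \int[P]_w (X w i j ^+ 2) ^+ 2 <= K.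
Proof.
apply: (subG_quartic i (delta_mx j 0)).
  rewrite (bigD1 j)//= big1 ?addr0 ?mxE ?eqxx ?expr1n// => k /negPf kj.
  by rewrite mxE kj expr0n.
move=> w; rewrite (bigD1 j)//= big1 ?addr0 ?mxE ?eqxx ?mul1r// => k /negPf kj.
by rewrite mxE kj mul0r.
Qed.

Section direction.
Variable u : 'cV[R]_p.
Hypothesis u1 : \sum_j u j 0 ^+ 2 = 1.
Let f i w := \sum_k u k 0 * X w i k.
(** The contribution of row [i] to coordinate [j] of [X^T X u - n u]; it is centered by isotropy. *)
Let zeta i j w := X w i j * f i w - u j 0.

Let mf i : measurable_fun setT (f i).
Proof. by apply: measurable_sum => k; exact: measurable_funM. Qed.

Let sqintX i j : sqint (fun w => X w i j).
Proof. by split => //; apply: integrable_sqint; have [] := subG_entry_quartic i j. Qed.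

Let Xf i j : sqint (fun w => X w i j * f i w) /\ \int[P]_w (X w i j * f i w) ^+ 2 <= K.
Proof.
have [sX kX] := subG_entry_quartic i j.
have [sf kf] := subG_quartic i u (f i) u1 (fun w => erefl).
have L := integrableM_sqint P _ _ sX sf.
have E : (fun w => (X w i j * f i w) ^+ 2) = fun w => X w i j ^+ 2 * f i w ^+ 2.
  by apply/funext => w; rewrite exprMn.
split; first by split; [exact: measurable_funM|rewrite E].
(* The product of two squares is at most half the sum of their squares, which leaves only the fourth
   moments bounded by [K]. *)
rewrite E; apply: (@le_trans _ _ (\int[P]_w (2^-1 * ((X w i j ^+ 2) ^+ 2 + (f i w ^+ 2) ^+ 2)))).
  have Ls : L1 (fun w => (X w i j ^+ 2) ^+ 2 + (f i w ^+ 2) ^+ 2).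
    by apply: integrable_addr; [case: sX|case: sf].
  apply: le_Rintegral => //; first exact: integrableZr.
  by move=> w _; have := sqr_ge0 (X w i j ^+ 2 - f i w ^+ 2); nra.
rewrite RintegralZl//; last by apply: integrable_addr; [case: sX|case: sf].
rewrite RintegralD//; [lra|by case: sX|by case: sf].
Qed.

Let int_Xf i j : \int[P]_w (X w i j * f i w) = u j 0.
Proof.
have [_ [_ [_ [_ [H _]]]]] := SX.
have LXX k : L1 (fun w => X w i j * X w i k).
  by apply: integrableM_sqint; exact: sqintX.
rewrite (_ : (fun w => _) = fun w => \sum_k u k 0 * (X w i j * X w i k)); last first.
  by apply/funext => w; rewrite /f mulr_sumr; apply: eq_bigr => k _; ring.
rewrite Rintegral_sumr; last by move=> k; exact: integrableZr.
rewrite (eq_bigr (fun k => u k 0 * (j == k)%:R)); last first.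
  by move=> k _; rewrite RintegralZl// /Rintegral H.
rewrite (bigD1 j)//= big1 ?addr0 ?eqxx ?mulr1// => k kj.
by rewrite eq_sym (negPf kj) mulr0.
Qed.

Let sqint_zeta i j : sqint (zeta i j).
Proof. by apply: sqintD; [have [] := Xf i j|exact: sqint_cst]. Qed.

Let int_zeta i j : \int[P]_w zeta i j w = 0.
Proof.
have L := integrable_sqint P _ (Xf i j).1.
have Lc := integrable_sqint P _ (sqint_cst P (u j 0)).
by rewrite RintegralB// int_Xf Rintegral_probability_cst subrr.
Qed.

Let int_zeta2 i j : \int[P]_w (zeta i j w ^+ 2) <= K.
Proof.
have [sXf kXf] := Xf i j; have L := integrable_sqint P _ sXf.
apply: le_trans kXf.
have Lc : L1 (fun=> u j 0 ^+ 2) by exact: integrable_sqint (sqint_cst P _).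
rewrite (_ : (fun w => zeta i j w ^+ 2) = fun w => (X w i j * f i w) ^+ 2 + ((- (2 * u j 0)) * (X w i j * f i w) + u j 0 ^+ 2)); last first.
  by apply/funext => w; rewrite /zeta; ring.
have L2 : L1 (fun w => (- (2 * u j 0)) * (X w i j * f i w)) by exact: integrableZr.
rewrite RintegralD//; [|by case: sXf|exact: integrable_addr].
rewrite RintegralD// RintegralZl// int_Xf Rintegral_probability_cst.
by have := sqr_ge0 (u j 0); nra.
Qed.

Let int_zeta_cross i i' j : i != i' -> \int[P]_w (zeta i j w * zeta i' j w) = 0.
Proof.
move=> ii'; apply: Rintegral_mul_indep => // A B mA mB.
have mzeta k C : measurable C -> measurable (zeta k j @^-1` C : set (design_space 1 p (fun w => row k (X w)))).
  move=> mC.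
  have mrow := measurable_design 1 p (fun w => row k (X w)).
  pose Xk (w : design_space 1 p (fun w => row k (X w))) : 'M[R]_(1, p) := row k (X w).
  have mz : measurable_fun setT (fun w => Xk w 0 j * (\sum_l u l 0 * Xk w 0 l) - u j 0).
    apply: measurable_funB; last exact: measurable_cst.
    apply: measurable_funM; first exact: mrow.
    by apply: measurable_sum => l; apply: measurable_funM; [exact: measurable_cst|exact: mrow].
  have := mz measurableT C mC; rewrite setTI.
  rewrite (_ : _ @^-1` C = zeta k j @^-1` C)//.
  apply/seteqP; split => w; rewrite /= /zeta /f /Xk mxE;
    by under eq_bigr do rewrite mxE.
exact: subG_row_indep (mzeta i A mA) (mzeta i' B mB).
Qed.

(** Rows are independent and the [zeta] are centered, so in each of the [p] coordinates only the [n]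
    diagonal terms survive, each at most [K]. *)
Lemma subG_gram_second_moment :
  let Q w := \sum_j (((X w)^T *m X w *m u - n%:R *: u) j 0) ^+ 2 in
  L1 Q /\ \int[P]_w Q w <= p%:R * n%:R * K.
Proof.
move=> Q.
have QE : Q = fun w => \sum_j \sum_i \sum_i' zeta i j w * zeta i' j w.
  apply/funext => w; apply: eq_bigr => j _.
  rewrite expr2.
  have -> : ((X w)^T *m X w *m u - n%:R *: u) j 0 = \sum_i zeta i j w.
    rewrite -mulmxA !mxE /zeta sumrB sumr_const card_ord mulr_natl; congr (_ - _).
    apply: eq_bigr => i _; rewrite !mxE; congr (_ * _).
    by apply: eq_bigr => k _; rewrite mulrC.
  by rewrite mulr_suml; apply: eq_bigr => i _; rewrite mulr_sumr.
have L i i' j : L1 (fun w => zeta i j w * zeta i' j w) by exact: integrableM_sqint.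
split.
  by rewrite QE; do 3 (apply: integrable_sumr => ?).
rewrite QE Rintegral_sumr; last by move=> j; do 2 (apply: integrable_sumr => ?).
apply: (@le_trans _ _ (\sum_(j < p) n%:R * K)); last first.
  by rewrite sumr_const card_ord -mulrA [leRHS]mulr_natl.
apply: ler_sum => j _; rewrite Rintegral_sumr; last by move=> i; apply: integrable_sumr.
apply: (@le_trans _ _ (\sum_(i < n) K)); last first.
  by rewrite sumr_const card_ord [leRHS]mulr_natl.
apply: ler_sum => i _; rewrite Rintegral_sumr// (bigD1 i)//= big1 ?addr0.
  by under eq_Rintegral do rewrite -expr2.
by move=> i' i'i; apply: int_zeta_cross; rewrite eq_sym.
Qed.

End direction.

(** Markov's inequality for the squared deviation along the unit vector [u] proportional to [b]; the
    factor [n] of its mean cancels against the allowed size [n]. *)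
Lemma subG_good_design_ge (b : 'cV[R]_p) : (0 < n)%N -> 0 < \sum_j b j 0 ^+ 2 ->
  1 - p%:R * K * \sum_j b j 0 ^+ 2 <= fine (P (good_design n p X b (Num.sqrt n%:R))).
Proof.
move=> n0 b0; set B2 := \sum_j b j 0 ^+ 2 in b0 *.
have n0R : 0 < n%:R :> R by rewrite ltr0n.
pose u := (Num.sqrt B2)^-1 *: b.
have sB : Num.sqrt B2 != 0 by rewrite gt_eqF// sqrtr_gt0.
have bE : b = Num.sqrt B2 *: u by rewrite /u scalerA mulfV// scale1r.
have u1 : \sum_j u j 0 ^+ 2 = 1.
  rewrite (eq_bigr (fun j => B2^-1 * b j 0 ^+ 2)); last first.
    by move=> j _; rewrite mxE exprMn exprVn sqr_sqrtr// ltW.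
  by rewrite -mulr_sumr mulVf// gt_eqF.
have [] := subG_gram_second_moment u u1.
set Q := (X in L1 X); move=> LQ kQ.
have Q0 w : 0 <= Q w by apply: sumr_ge0 => j _; exact: sqr_ge0.
have mQ : measurable_fun setT Q by apply/measurable_EFinP; exact: measurable_int LQ.
have QE w : \sum_j ((X w)^T *m X w *m b - n%:R *: b) j 0 ^+ 2 = B2 * Q w.
  rewrite /Q mulr_sumr; apply: eq_bigr => j _.
  have -> : (X w)^T *m X w *m b - n%:R *: b = Num.sqrt B2 *: ((X w)^T *m X w *m u - n%:R *: u).
    by rewrite [in LHS]bE -scalemxAr scalerBr !scalerA [n%:R * _]mulrC.
  by rewrite [in LHS]mxE exprMn sqr_sqrtr// ltW.
have GE : good_design n p X b (Num.sqrt n%:R) = [set w | B2 * Q w <= n%:R].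
  by apply/seteqP; split => w; rewrite /good_design /= sqr_sqrtr// QE.
have mG : measurable [set w | B2 * Q w <= n%:R].
  rewrite -[X in measurable X]setTI; apply: measurable_fun_le => //.
  exact: measurable_funM.
rewrite GE; set G := [set w | _] in mG *.
have GC : P G = (1 - P (~` G))%E.
  by rewrite -[in LHS](setCK G) probability_setC//; exact: measurableC.
have mGC : measurable (~` G) by exact: measurableC.
have bad : fine (P (~` G)) <= p%:R * K * B2.
  rewrite -lee_fin fineK ?fin_num_measure//.
  apply: (@le_trans _ _ (\int[P]_w ((B2 / n%:R) * Q w)%:E)%E).
    rewrite -(setIT (~` G)) -(integral_indic P measurableT mGC).
    apply: ge0_le_integral => //.
    - by apply/measurable_EFinP; exact: measurable_indic.
    - by apply/measurable_EFinP; exact: measurable_funM.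
    - move=> w _; rewrite lee_fin indicE; have [wG|_] := boolP (w \in ~` G); last first.
        by rewrite mulr_ge0// divr_ge0// ltW.
      move/set_mem : wG => /negP; rewrite -ltNge => nQ.
      by rewrite mulrAC ler_pdivlMr// mul1r ltW.
  have LQ' : L1 (fun w => B2 / n%:R * Q w) by exact: integrableZr.
  rewrite -[leLHS]fineK; last exact: (integrable_fin_num measurableT LQ').
  rewrite lee_fin -[leLHS]/(\int[P]_w (B2 / n%:R * Q w)) RintegralZl//.
  apply: (@le_trans _ _ (B2 / n%:R * (p%:R * n%:R * K))).
    by rewrite ler_wpM2l// divr_ge0// ltW.
  rewrite le_eqVlt; apply/orP; left; apply/eqP; field.
  by rewrite gt_eqF.
rewrite GC fineB//=; last by rewrite fin_num_measure.
lra.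
Qed.

End subG.

(** * Error exponents *)

(** Induction by the absorption identity; with [j] the exponent in the induction hypothesis, the
    step rests on [(p + 1) * j <= p * (j + 1)] for [j <= p]. *)
Lemma expn_le_bin (p k : nat) : (k <= p)%N -> (p ^ k <= 'C(p, k) * k ^ k)%N.
Proof.
elim: k p => [|k IHk] [|p] // kp.
have kp' : (k <= p)%N by [].
have E : (k.+1 * 'C(p.+1, k.+1) = p.+1 * 'C(p, k))%N by rewrite -mul_bin_diag.
rewrite expnS [X in (_ <= _ * X)%N]expnS mulnA [('C(_, _) * _)%N]mulnC E -mulnA leq_mul2l /=.
case: k IHk kp kp' E => [|k] IHk kp kp' E; first by rewrite bin0.
rewrite -(@leq_pmul2r (k.+1 ^ k.+1)) ?expn_gt0//.
rewrite -expnMn; apply: (@leq_trans ((p * k.+2) ^ k.+1)%N).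
  by rewrite leq_exp2r// mulSn [(_ * k.+2)%N]mulnS leq_add2r.
rewrite expnMn mulnAC leq_mul2r; apply/orP; right.
exact: IHk.
Qed.

Section real_bounds.
Context {R : realType}.
Notation gam := (@normal_prob R 0 1).

Lemma expR_le_1B (x : R) : 0 <= x <= 2^-1 -> expR (- (2 * x)) <= 1 - x.
Proof.
move=> /andP[x0 x1]; rewrite expRN invf_ple ?posrE ?expR_gt0//; last lra.
apply: le_trans (expR_ge1Dx (2 * x)).
rewrite -[leLHS]mul1r ler_pdivrMr; [nra|lra].
Qed.

Let C0 : R := - ln (normal_peak 1).

Let peakE : normal_peak 1 = expR (- C0) :> R.
Proof. by rewrite /C0 opprK lnK// posrE normal_peak_gt0// oner_neq0. Qed.

Lemma bin_ge (p k : nat) : (0 < k)%N -> (k <= p)%N ->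
  expR (k%:R * (ln p%:R - ln k%:R)) <= 'C(p, k)%:R :> R.
Proof.
move=> k0 kp; have p0 : (0 < p)%N by exact: leq_trans kp.
have lnX (m : nat) : (0 < m)%N -> expR (k%:R * ln m%:R) = m%:R ^+ k :> R.
  by move=> m0; rewrite expRM_natl lnK// posrE ltr0n.
rewrite mulrBr expRD expRN !lnX// ler_pdivrMr ?exprn_gt0 ?ltr0n//.
by rewrite -!natrX -natrM ler_nat expn_le_bin.
Qed.

Variables (p : nat) (tau : R).
Hypothesis tauE : tau ^+ 2 = 2 * ln p%:R.
Hypothesis p0 : (0 < p)%N.
Hypothesis tau4 : 4 <= tau.

Let p0R : 0 < p%:R :> R. Proof. by rewrite ltr0n. Qed.

(** Since [p = expR (tau ^+ 2 / 2)], lowering the threshold by 1 leaves [p * y] below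
    [2 * expR tau], and [1 - y >= expR (- (2 * y))]. The cost [4 * expR tau] is a lower-order term
    because [s] is a positive power of [p]. *)
Lemma normal_prob_inner_ge (j : nat) : (j <= p)%N ->
  expR (- (4 * expR tau)) <= fine (gam [set z : R | `|z| <= tau - 1]) ^+ j.
Proof.
move=> jp; pose y : R := 2 * expR (- ((tau - 1) ^+ 2 / 2)).
have y0 : 0 <= y by rewrite mulr_ge0// expR_ge0.
have y1 : y <= 2^-1.
  have H : 4 <= expR ((tau - 1) ^+ 2 / 2).
    apply: le_trans (expR_ge1Dx _).
    have : 0 <= (tau - 4) * (tau + 2) by apply: mulr_ge0; have := tau4; lra.
    nra.
  rewrite /y expRN ler_pdivrMr ?expR_gt0//; lra.
have yq : 1 - y <= fine (gam [set z : R | `|z| <= tau - 1]).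
  by apply: normal_prob_norm_le_ge; have := tau4; rewrite subr_ge0 => /(le_trans _); apply; lra.
have y10 : 0 <= 1 - y by lra.
apply: (@le_trans _ _ ((1 - y) ^+ j)); last by apply: lerXn2r; rewrite ?nnegrE// (le_trans y10).
apply: (@le_trans _ _ ((1 - y) ^+ p)); last first.
  by apply: ler_wiXn2l jp => //; rewrite gerBl.
apply: (@le_trans _ _ (expR (- (2 * y)) ^+ p)); last first.
  by apply: lerXn2r; rewrite ?nnegrE ?expR_ge0//; apply: expR_le_1B; rewrite y0.
rewrite -expRM_natr ler_expR mulNr lerN2.
have -> : 2 * y * p%:R = 4 * (expR (- ((tau - 1) ^+ 2 / 2)) * p%:R) by rewrite /y; ring.
rewrite ler_pM2l// -[p%:R]lnK ?posrE// -expRD ler_expR.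
have -> : ln p%:R = tau ^+ 2 / 2 by rewrite tauE mulrC mulKf.
nra.
Qed.

Let mono (A B : set R) : measurable A -> measurable B -> A `<=` B ->
  fine (gam A) <= fine (gam B).
Proof.
move=> mA mB AB; rewrite -lee_fin !fineK ?fin_num_measure//.
by apply: le_measure => //; rewrite inE.
Qed.

Let m_le (c : R) : measurable [set z : R | `|z| <= c].
Proof.
rewrite -[X in measurable X]setTI.
exact: (measurable_fun_le measurableT (@normr_measurable R setT) (measurable_cst _)).
Qed.

(** The tail beyond [tau] is bounded below on [[tau + 1, tau + 2]]. The exponent
    [(tau + 2) ^+ 2 / 2] cancels [ln p = tau ^+ 2 / 2] from the binomial coefficient up to
    [2 * tau + 2], so [ln k] is the main term left. *)
Lemma null_exponent (k : nat) : (0 < k)%N -> (k <= p)%N ->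
  expR (- (k%:R * (ln k%:R + C0 + 2 * tau + 2) + 4 * expR tau)) <=
  'C(p, k)%:R * fine (gam [set z : R | tau < `|z|]) ^+ k *
    fine (gam [set z : R | `|z| <= tau]) ^+ (p - k).
Proof.
move=> k0 kp; have t4 := tau4.
have -> : - (k%:R * (ln k%:R + C0 + 2 * tau + 2) + 4 * expR tau) =
  k%:R * (ln p%:R - ln k%:R) + k%:R * (- C0 + - ((tau + 2) ^+ 2 / 2)) + - (4 * expR tau).
  have -> : ln p%:R = tau ^+ 2 / 2 by rewrite tauE mulrC mulKf.
  by field.
rewrite 2!expRD; apply: ler_pM; rewrite ?mulr_ge0 ?expR_ge0//; last first.
  apply: (le_trans (normal_prob_inner_ge (p - k) (leq_subr _ _))).
  apply: lerXn2r; rewrite ?nnegrE ?fine_ge0//.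
  by apply: mono; [exact: m_le|exact: m_le|move=> z /= H; apply: (le_trans H); rewrite gerBl].
apply: ler_pM; rewrite ?expR_ge0//; first exact: bin_ge.
rewrite expRM_natl expRD -peakE; apply: lerXn2r; rewrite ?nnegrE ?fine_ge0//.
  by rewrite mulr_ge0 ?expR_ge0// normal_peak_ge0.
apply: (@le_trans _ _ (fine (gam `[tau + 1, tau + 1 + 1]))).
  apply: normal_prob_unit_itv_ge; rewrite ger0_norm; lra.
apply: mono => //.
  rewrite (_ : [set _ | _] = ~` [set z | `|z| <= tau]); first by apply: measurableC; exact: m_le.
  by apply/seteqP; split => z /=; rewrite ltNge => /negP.
move=> z /=; rewrite in_itv /= => /andP[z1 _]; apply: lt_le_trans (ler_norm z).
lra.
Qed.

Lemma alternative_exponent (v m : R) (k s : nat) (g : R) :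
  1 <= v -> 0 <= m <= v * tau -> (k <= s)%N -> (s <= p)%N -> 2^-1 <= g ->
  exists2 x : R, (forall z, x <= z <= x + 1 -> `|z + m| <= tau - 1) &
  expR (- (ln 2 + (s - k)%:R * (C0 + ((v - 1) * tau + 2) ^+ 2 / 2) + 4 * expR tau)) <=
  g * fine (gam `[x, (x + 1)]) ^+ (s - k) *
    fine (gam [set z : R | `|z| <= tau - 1]) ^+ (p - s).
Proof.
move=> v1 /andP[m0 mv] ks sp g2; have t4 := tau4.
(* The witness is [x = min (0, tau - m) - 2]: adding [m] to the interval brings its upper end to at
   most [tau - 1], and [4 <= tau] keeps its lower end above [- (tau - 1)]. *)
have [x [xK x1K xB]] : exists x, [/\ `|x| <= (v - 1) * tau + 2, `|x + 1| <= (v - 1) * tau + 2 &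
    forall z, x <= z <= x + 1 -> `|z + m| <= tau - 1].
  have vt : 0 <= (v - 1) * tau by apply: mulr_ge0; lra.
  have [mt|tm] := leP m tau.
    exists (- 2); split; rewrite ?ler_norml; [apply/andP; split; lra|apply/andP; split; lra|].
    by move=> z /andP[z1 z2]; rewrite ler_norml; apply/andP; split; lra.
  have mt : m - tau <= (v - 1) * tau by rewrite mulrBl mul1r lerD2r.
  exists (tau - m - 2); split; rewrite ?ler_norml; [apply/andP; split; lra|apply/andP; split; lra|].
  by move=> z /andP[z1 z2]; rewrite ler_norml; apply/andP; split; lra.
exists x => //.
rewrite opprD expRD; apply: ler_pM; rewrite ?expR_ge0//; last first.
  exact: normal_prob_inner_ge (leq_subr _ _).
rewrite opprD expRD; apply: ler_pM; rewrite ?expR_ge0//.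
  by rewrite expRN lnK ?posrE.
rewrite -mulrN expRM_natl opprD expRD -peakE; apply: lerXn2r; rewrite ?nnegrE ?fine_ge0//.
  by rewrite mulr_ge0 ?expR_ge0// normal_peak_ge0.
exact: normal_prob_unit_itv_ge.
Qed.

End real_bounds.

Section asymptotics.
Context {R : realType}.

Lemma affine_le_sqr_near (c1 c2 e : R) : 0 < e ->
  \forall x \near +oo, c1 * x + c2 <= e * x ^+ 2.
Proof.
move=> e0; near=> x.
have x1 : 1 <= x by near: x; apply: nbhs_pinfty_ge; exact: num_real.
have xe : (`|c1| + `|c2|) / e <= x by near: x; apply: nbhs_pinfty_ge; exact: num_real.
have H : (`|c1| + `|c2|) * x <= e * x ^+ 2.
  have x0 : 0 <= x by apply: le_trans x1.
  rewrite expr2 mulrA ler_wpM2r//.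
  by move: xe; rewrite ler_pdivrMr// mulrC.
apply: le_trans H; rewrite mulrDl; apply: lerD.
  by rewrite ler_wpM2r ?ler_norm//; lra.
by apply: (le_trans (ler_norm _)); have := normr_ge0 c2; nra.
Unshelve. all: by end_near. Qed.

(* The two error exponents for the threshold [kappa * s] are [kappa * (1 - alpha)] and
   [(1 - kappa) * (sqrt r - 1) ^ 2]; each endpoint value is at most the optimal exponent
   [E] on its own side of [r + alpha = 2 sqrt r]. *)
Lemma threshold_exists (alpha r : R) : 1 / 2 < alpha < 1 -> alpha < r ->
  let E := (r - alpha) ^+ 2 / (4 * r) in
  let v := Num.max (Num.sqrt r) 1 in
  exists kappa, [/\ 0 < kappa < 1, kappa * (1 - alpha) < E & (1 - kappa) * (v - 1) ^+ 2 < E].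
Proof.
move=> /andP[a1 a2] ar E v.
have r0 : 0 < r by lra.
have E0 : 0 < E by rewrite divr_gt0 ?exprn_gt0 ?mulr_gt0// subr_gt0.
have v1 : 1 <= v by rewrite /v le_max lexx orbT.
pose b := (v - 1) ^+ 2; have b0 : 0 <= b by exact: sqr_ge0.
have [aE|Ea] := leP (1 - alpha) E.
  pose e := Num.min (1 / 2) (E / (2 * (b + 1))).
  have e0 : 0 < e by rewrite /e lt_min !divr_gt0// mulr_gt0//; lra.
  have e2 : e <= 1 / 2 by rewrite /e ge_min lexx.
  exists (1 - e); split.
  - by apply/andP; split; lra.
  - apply: lt_le_trans aE; nra.
  - rewrite opprB addrCA subrr addr0 -/b.
    have : e <= E / (2 * (b + 1)) by rewrite /e ge_min lexx orbT.
    rewrite ler_pdivlMr; last by lra.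
    nra.
have bE : b <= E.
  have [r1|r1] := leP r 1.
    have -> : b = 0.
      rewrite /b /v max_r ?subrr ?expr0n// -[leRHS]sqrtr1 ler_sqrt//.
    exact: ltW.
  pose w := Num.sqrt r; have w1 : 1 < w by rewrite /w -[ltLHS]sqrtr1 ltr_sqrt.
  have rE : r = w ^+ 2 by rewrite /w sqr_sqrtr// ltW.
  have -> : b = (w - 1) ^+ 2 by rewrite /b /v max_l// -/w ltW.
  move: Ea; rewrite /E rE ltr_pdivrMr ?ler_pdivlMr; [|nra|nra].
  move=> Ea.
  (* Adding [4 * alpha * r] to both sides of [(r - alpha) ^+ 2 < 4 * r * (1 - alpha)] completes the
     square to [r + alpha < 2 * w]. *)
  have h1 : (w ^+ 2 + alpha) ^+ 2 < (2 * w) ^+ 2 by nra.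
  have h2 : w ^+ 2 + alpha < 2 * w by rewrite -ltr_sqr// nnegrE; nra.
  have h3 : 0 <= (w - 1) * (2 * w) by nra.
  have h4 : (w - 1) * (2 * w) <= w ^+ 2 - alpha by nra.
  have -> : (w - 1) ^+ 2 * (4 * w ^+ 2) = ((w - 1) * (2 * w)) ^+ 2 by ring.
  by rewrite ler_sqr// nnegrE (le_trans h3).
pose e := Num.min (1 / 2) (E / 2).
have e0 : 0 < e by rewrite /e lt_min; apply/andP; split; lra.
have e2 : e <= 1 / 2 by rewrite /e ge_min lexx.
have e3 : e <= E / 2 by rewrite /e ge_min lexx orbT.
exists e; split.
- by apply/andP; split; lra.
- nra.
- rewrite -/b; have [b00|b00] := leP b 0; nra.
Qed.

(** The limit is taken in the real variable [tau], with [p] tied to it by an equation; every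
    lower-order term is then compared with [tau ^+ 2 = 2 * ln p]. *)
Lemma exponents_near (a v kappa C0 E : R) : 0 < a <= 1 -> 0 < kappa < 1 ->
  kappa * a < E -> (1 - kappa) * (v - 1) ^+ 2 < E ->
  exists2 c, c < E & \forall tau \near +oo, forall p s : nat,
    tau ^+ 2 = 2 * ln p%:R -> (0 < p)%N -> s = Num.truncn (p%:R `^ a) ->
    let k := (Num.truncn (kappa * s%:R)).+1 in
    [/\ 4 <= tau, (0 < s)%N, (k <= s)%N,
      k%:R * (ln k%:R + C0 + 2 * tau + 2) + 4 * expR tau <= c * (s%:R * ln p%:R) &
      ln 2 + (s - k)%:R * (C0 + ((v - 1) * tau + 2) ^+ 2 / 2) + 4 * expR tau
        <= c * (s%:R * ln p%:R)].
Proof.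
move=> /andP[a0 a1] /andP[k0 k1] kE vE; set b := (v - 1) ^+ 2 in vE *.
pose M := Num.max (kappa * a) ((1 - kappa) * b).
have ME : M < E by rewrite /M gt_max kE vE.
(* The lower-order terms below use up at most [4 * e], and [M + 6 * e] is still less than [E]. *)
pose e := Num.min 1 ((E - M) / 8).
have e0 : 0 < e by rewrite /e lt_min ltr01 divr_gt0// subr_gt0.
have e1 : e <= 1 by rewrite /e ge_min lexx.
have e8 : e <= (E - M) / 8 by rewrite /e ge_min lexx orbT.
have M1 : kappa * a <= M by rewrite /M le_max lexx.
have M2 : (1 - kappa) * b <= M by rewrite /M le_max lexx orbT.
have a20 : 0 < a / 2 by lra.
have e20 : 0 < e / 2 by lra.
exists (M + 6 * e); first lra.
near=> tau.
(* The successor makes [k] positive and gives [s - k <= (1 - kappa) * s]. *)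
move=> p s tauE p0 sE; set k := (Num.truncn _).+1.
have t4 : 4 <= tau by near: tau; apply: nbhs_pinfty_ge; exact: num_real.
have H3 : 2 * tau + (C0 + 2) <= e / 2 * tau ^+ 2 by near: tau; exact: affine_le_sqr_near.
have H4 : (2 * (v - 1)) * tau + (C0 + 2) <= e / 2 * tau ^+ 2 by near: tau; exact: affine_le_sqr_near.
(* [a / 2 * tau ^+ 2] is the logarithm of [p ^ a], which is [s] up to rounding: this bound and the
   following ones make [expR tau] and constants negligible against [s]. *)
have H5 : 1 * tau + ln (8 / e) <= a / 2 * tau ^+ 2 by near: tau; exact: affine_le_sqr_near.
have H7 : 0 * tau + ln (2 / e) <= a / 2 * tau ^+ 2 by near: tau; exact: affine_le_sqr_near.
have H8 : 0 * tau + ln 2 <= a / 2 * tau ^+ 2 by near: tau; exact: affine_le_sqr_near.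
have Hk : 0 * tau + ln (2 / (1 - kappa)) <= a / 2 * tau ^+ 2 by near: tau; exact: affine_le_sqr_near.
set l := ln p%:R in tauE *.
have lE : l = tau ^+ 2 / 2 by rewrite tauE mulrC mulKf.
have l1 : 1 <= l by rewrite lE; nra.
have paE : p%:R `^ a = expR (a * l) by rewrite /powR gt_eqF ?ltr0n.
have aE : a / 2 * tau ^+ 2 = a * l by rewrite lE; ring.
rewrite aE in H5 H7 H8 Hk.
set q := expR (a * l) in paE.
have eln (x : R) : 0 < x -> ln x <= a * l -> x <= q.
  by move=> x0 H; rewrite -[x]lnK ?posrE// ler_expR.
have q2 : 2 <= q by apply: eln => //; lra.
have qe : 2 / e <= q by apply: eln; [exact: divr_gt0|lra].
have q5 : expR tau * (8 / e) <= q.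
  rewrite -[8 / e]lnK ?posrE ?divr_gt0// -expRD ler_expR; lra.
have q0 : 0 <= q by exact: expR_ge0.
have [s1 s2] : s%:R <= q /\ q < s%:R + 1.
  have /andP[h1 h2] := truncn_itv q0.
  by rewrite sE paE; split => //; rewrite natr1.
have sq : q / 2 <= s%:R by lra.
have s0 : 1 <= s%:R :> R by lra.
have s0n : (0 < s)%N by rewrite -(@ler_nat R).
have es : 1 <= e * s%:R.
  have : 1 <= e * (q / 2) by rewrite mulrA ler_pdivlMr// mul1r -ler_pdivrMl// mulrC.
  nra.
have e5 : 4 * expR tau <= e * (s%:R * l).
  move: q5; rewrite mulrA ler_pdivrMr// => q5.
  have : 4 * expR tau <= e * (q / 2) by lra.
  move=> /le_trans; apply; rewrite ler_pM2l//; nra.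
clear H5 H7 H8 Hk q5 qe s2 sq q2 aE.
have ks0 : 0 <= kappa * s%:R by rewrite mulr_ge0// ltW.
have /andP[kk1 kk2] := truncn_itv ks0.
have kR : k%:R = (Num.truncn (kappa * s%:R))%:R + 1 :> R by rewrite /k -natr1.
have k_gt : kappa * s%:R < k%:R by exact: kk2.
have k_le : k%:R <= kappa * s%:R + 1 by rewrite kR lerD2r.
have ks : (k <= s)%N.
  rewrite /k -(@ltr_nat R); apply: (le_lt_trans kk1); nra.
have skR : (s - k)%:R <= (1 - kappa) * s%:R by rewrite natrB//; lra.
have l0 : 0 < l by exact: lt_le_trans l1.
have sl0 : 0 < s%:R * l by rewrite mulr_gt0// ltr0n.
clear kk1 kk2 kR k_gt; split => //.
- have lnk : ln k%:R <= a * l.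
    have -> : a * l = ln q by rewrite /q expRK.
    rewrite ler_ln ?posrE ?expR_gt0 ?ltr0n//.
    by apply: le_trans s1; rewrite ler_nat.
  have kl : k%:R <= (kappa + e) * s%:R by lra.
  have B : ln k%:R + C0 + 2 * tau + 2 <= (a + e) * l by rewrite lE in lnk *; lra.
  have k0R : 0 <= k%:R :> R by [].
  have ae0 : 0 <= (a + e) * l by rewrite mulr_ge0 ?addr_ge0// ltW.
  have T1 : k%:R * (ln k%:R + C0 + 2 * tau + 2) <= (kappa + e) * s%:R * ((a + e) * l).
    by apply: (@le_trans _ _ (k%:R * ((a + e) * l))); [rewrite ler_wpM2l|rewrite ler_wpM2r].
  have T2 : (kappa + e) * s%:R * ((a + e) * l) = ((kappa + e) * (a + e)) * (s%:R * l) by ring.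
  have T3 : (kappa + e) * (a + e) <= M + 3 * e by nra.
  have T4 : ((kappa + e) * (a + e)) * (s%:R * l) <= (M + 3 * e) * (s%:R * l) by rewrite ler_wpM2r// ltW.
  have := ltW (mulr_gt0 e0 sl0); lra.
- have l2 : ln 2 <= 1 :> R.
    by rewrite -[leRHS]expRK ler_ln ?posrE ?expR_gt0//; apply: le_trans (expR_ge1Dx _); lra.
  have B : C0 + ((v - 1) * tau + 2) ^+ 2 / 2 <= (b + e) * l.
    have -> : C0 + ((v - 1) * tau + 2) ^+ 2 / 2 = b * l + (2 * (v - 1) * tau + (C0 + 2)).
      by rewrite lE /b; field.
    rewrite [(b + e) * l]mulrDl lerD2l lE; lra.
  have be0 : 0 <= (b + e) * l by rewrite mulr_ge0 ?addr_ge0 ?sqr_ge0// ltW.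
  have T1 : (s - k)%:R * (C0 + ((v - 1) * tau + 2) ^+ 2 / 2) <= (1 - kappa) * s%:R * ((b + e) * l).
    by apply: (@le_trans _ _ ((s - k)%:R * ((b + e) * l))); [rewrite ler_wpM2l|rewrite ler_wpM2r].
  have T2 : (1 - kappa) * s%:R * ((b + e) * l) = ((1 - kappa) * (b + e)) * (s%:R * l) by ring.
  have T3 : (1 - kappa) * (b + e) <= M + e by nra.
  have T4 : ((1 - kappa) * (b + e)) * (s%:R * l) <= (M + e) * (s%:R * l) by rewrite ler_wpM2r// ltW.
  have T5 : 1 <= e * (s%:R * l) by rewrite mulrA -[leLHS]mulr1 ler_pM.
  have := ltW (mulr_gt0 e0 sl0); lra.
Unshelve. all: by end_near. Qed.

End asymptotics.

(** * From the exponents to the risk of the test *)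

Section risk.
Context {R : realType}.

Lemma sum_ord_lt (p s : nat) (c : R) : (s <= p)%N ->
  \sum_(j < p) (if (j < s)%N then c else 0) = c * s%:R.
Proof.
move=> sp; rewrite -big_mkcond /= -(big_ord_widen p (fun=> c) sp).
by rewrite sumr_const card_ord mulr_natr.
Qed.

Lemma Xi_col_prefix (p s : nat) (A : R) : (s <= p)%N -> 0 < A ->
  Xi s A (\col_(j < p) (if (j < s)%N then A else 0)).
Proof.
move=> sp A0; split.
  rewrite (@eq_card _ _ (mem [set i : 'I_p | (i < s)%N]%SET)); last first.
    move=> i; rewrite !inE; apply/idP/idP => [/set_mem /=|si].
      by rewrite mxE; case: ifP => // _; rewrite eqxx.
    by apply/mem_set => /=; rewrite mxE si gt_eqF.
  rewrite -sum1_card (eq_bigl (fun i : 'I_p => (i < s)%N)); last by move=> i; rewrite inE.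
  by rewrite -(big_ord_widen p (fun=> 1%N) sp) sum1_card card_ord.
by move=> i; rewrite mxE; case: ifP => _; rewrite ?eqxx// ler_norm.
Qed.

Lemma Risk_ge {d : measure_display} {Om : measurableType d} (P : probability Om R)
    (n p s : nat) (X : Om -> 'M[R]_(n, p)) (eps : Om -> 'cV[R]_n) (t tau A : R)
    (b : 'cV[R]_p) (c : \bar R) : Xi s A b ->
  (c <= Ebeta P X eps 0 (xi_test t tau))%E \/
  (c <= Ebeta P X eps b (fun y X => (1 - xi_test t tau y X)%R))%E ->
  (c <= Risk P X eps (xi_test t tau) s A)%E.
Proof.
move=> bX H.
have E0 : (0 <= Ebeta P X eps 0 (xi_test t tau))%E.
  by apply: integral_ge0 => w _; rewrite lee_fin /xi_test; case: ifP.
have E1 : (0 <= Ebeta P X eps b (fun y X => (1 - xi_test t tau y X)%R))%E.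
  by apply: integral_ge0 => w _; rewrite lee_fin /xi_test; case: ifP => _; rewrite ?subrr ?subr0.
have Es : (Ebeta P X eps b (fun y X => (1 - xi_test t tau y X)%R) <=
   ereal_sup [set Ebeta P X eps b (fun y X => (1 - xi_test t tau y X)%R) | b in Xi s A])%E.
  by apply: ereal_sup_ubound; exists b.
rewrite /Risk; case: H => H.
  by apply: (le_trans H); rewrite leeDl// (le_trans E1).
by apply: (le_trans H); apply: (le_trans Es); rewrite leeDr.
Qed.

Lemma ln_natr_near (L : R) : \forall p \near \oo, L <= ln p%:R.
Proof.
near=> p.
have H : expR L <= p%:R by near: p; exact: nbhs_infty_ger.
rewrite -[L]expRK ler_ln ?posrE ?expR_gt0//.
exact: (lt_le_trans (expR_gt0 L) H).
Unshelve. all: by end_near. Qed.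

Lemma sqrt_ln_near (Q : R -> Prop) : (\forall x \near +oo, Q x) ->
  \forall p \near \oo, Q (Num.sqrt (2 * ln (p%:R : R))).
Proof.
move=> [M [_ MQ]]; near=> p; apply: MQ.
have H : (`|M| + 1) ^+ 2 <= ln p%:R by near: p; exact: ln_natr_near.
apply: (le_lt_trans (ler_norm M)).
rewrite -[ltLHS]ger0_norm// -sqrtr_sqr ltr_sqrt; have := normr_ge0 M; nra.
Unshelve. all: by end_near. Qed.

End risk.

Section design.
Context {R : realType}.

(** What the two design classes are reduced to. The probability one half costs only the term [ln 2]
    in the exponent. *)
Definition regular_design {d : measure_display} {Om : measurableType d}
    (P : probability Om R) (n p s : nat) (X : Om -> 'M[R]_(n, p)) (A : R) : Prop :=
  [/\ forall i j, measurable_fun setT (fun w => X w i j),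
      (0 < p <= n)%N,
      {ae P, forall w, posdefmx ((X w)^T *m X w)} &
      2^-1 <= fine (P (good_design n p X (\col_j (if (j < s)%N then A else 0)) (Num.sqrt n%:R)))].

Lemma regular_orthdesign {d : measure_display} {Om : measurableType d}
    (P : probability Om R) (n p s : nat) (X : Om -> 'M[R]_(n, p)) (A : R) :
  Orthdesign X -> (0 < p <= n)%N -> regular_design P n p s X A.
Proof.
move=> [mX XX] pn; have /andP[p0 pn'] := pn.
have n0 : 0 < n%:R :> R by rewrite ltr0n (leq_trans p0).
split => //.
  apply: aeW => w v v0; rewrite XX mul_mx_scalar -scalemxAl mxE mulr_gt0//.
  rewrite mxE lt0r psumr_neq0; last by move=> k _; rewrite !mxE -expr2 sqr_ge0.
  rewrite sumr_ge0 ?andbT; last by move=> k _; rewrite !mxE -expr2 sqr_ge0.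
  have /cV0Pn [k vk] := v0; apply/hasP; exists k; first by rewrite mem_index_enum.
  by rewrite !mxE -expr2 lt0r sqr_ge0 sqrf_eq0 vk.
rewrite (_ : good_design _ _ _ _ _ = setT) ?probability_setT; first by rewrite /=; lra.
apply/seteqP; split => // w _; rewrite /good_design /= XX mul_scalar_mx sqr_sqrtr// subrr.
by rewrite big1// => j _; rewrite mxE expr0n.
Qed.

Lemma regular_subG_design {d : measure_display} {Om : measurableType d}
    (P : probability Om R) (n p s : nat) (sigma2 : R) (X : Om -> 'M[R]_(n, p)) (A : R) :
  SubG P sigma2 X -> (0 < p <= n)%N -> (0 < s <= p)%N -> 0 < A ->
  p%:R * (48 * expR (sigma2 / 2)) * (A ^+ 2 * s%:R) <= 2^-1 ->
  regular_design P n p s X A.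
Proof.
move=> SX pn /andP[s0 sp] A0 small; have /andP[p0 pn'] := pn.
split => //; [by case: SX|by have [_ [_ [_ [_ [_ [_]]]]]] := SX|].
set b := \col_j _.
have bE : \sum_j b j 0 ^+ 2 = A ^+ 2 * s%:R.
  rewrite -(sum_ord_lt p s _ sp); apply: eq_bigr => j _; rewrite mxE.
  by case: ifP => // _; rewrite expr0n.
have := subG_good_design_ge P n p sigma2 X SX b (leq_trans p0 pn').
have b0 : 0 < A ^+ 2 * s%:R by rewrite mulr_gt0 ?exprn_gt0// ltr0n.
by rewrite bE => /(_ b0); apply: le_trans; lra.
Qed.

(** The quantity is of order [p ^ (2 - alpha) * ln p / n]. Since [alpha > 1 / 2], the spare power
    [g = alpha - 1 / 2] absorbs the logarithm through [g * ln p <= p ^ g], which leaves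
    [p ^ (3 / 2) / n]. *)
Lemma design_size_near (alpha r K : R) (n : nat -> nat) :
  1 / 2 < alpha < 1 -> 0 < r -> 0 < K ->
  (fun p => (n p)%:R / (p%:R `^ (3 / 2)) : R) @ \oo --> +oo ->
  \forall p \near \oo,
    let s := Num.truncn ((p%:R : R) `^ (1 - alpha)) in
    let A := Num.sqrt (2 * r * ln (p%:R : R) / (n p)%:R) in
    (p <= n p)%N /\ p%:R * K * (A ^+ 2 * s%:R) <= 2^-1.
Proof.
move=> /andP[a1 a2] r0 K0 /cvgryPge hn.
pose g := alpha - 1 / 2; have g0 : 0 < g by rewrite /g; lra.
near=> p.
set s := Num.truncn _; set A := Num.sqrt _.
have l1 : 1 <= ln p%:R :> R by near: p; exact: ln_natr_near.
have p0 : (0 < p)%N.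
  by rewrite lt0n; apply: contraTneq l1 => ->; rewrite ln0// -ltNge ltr01.
have p0R : 0 < p%:R :> R by rewrite ltr0n.
have p1R : 1 <= p%:R :> R by rewrite ler1n.
have big : 1 + 4 * r * K / g <= (n p)%:R / p%:R `^ (3 / 2) by near: p; exact: hn.
have P0 : 0 < p%:R `^ (3 / 2) :> R by exact: powR_gt0.
have g4 : 0 < 4 * r * K / g by rewrite !mulr_gt0// invr_gt0.
have np : p%:R `^ (3 / 2) <= (n p)%:R :> R.
  have : 1 <= (n p)%:R / p%:R `^ (3 / 2) :> R by lra.
  by rewrite ler_pdivlMr// mul1r.
have pp : p%:R <= p%:R `^ (3 / 2) :> R.
  by rewrite -[leLHS]powRr1// ler_powR//; lra.
split; first by rewrite -(@ler_nat R) (le_trans pp).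
have n0 : 0 < (n p)%:R :> R by exact: lt_le_trans np.
set l := ln p%:R in l1 A *.
have lp : 0 <= l by lra.
have AE : A ^+ 2 = 2 * r * l / (n p)%:R.
  by rewrite sqr_sqrtr// divr_ge0// !mulr_ge0// ltW.
have s_le : s%:R <= p%:R `^ (1 - alpha) :> R.
  by have /andP[] := truncn_itv (powR_ge0 p%:R (1 - alpha)).
have sl : p%:R * l * s%:R <= p%:R `^ (3 / 2) / g.
  rewrite ler_pdivlMr//.
  have lg : l * g <= p%:R `^ g.
    by rewrite /powR gt_eqF// -/l mulrC; apply: le_trans (expR_ge1Dx _); rewrite lerDr.
  have -> : p%:R `^ (3 / 2) = p%:R * p%:R `^ g * p%:R `^ (1 - alpha) :> R.
    rewrite -[X in X * _ * _]powRr1// -!powRD; [congr (_ `^ _); rewrite /g; lra| |];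
      by apply/implyP => _; exact: lt0r_neq0.
  have -> : p%:R * l * s%:R * g = p%:R * (l * g) * s%:R :> R by ring.
  apply: ler_pM => //; first by rewrite !mulr_ge0// ltW.
  by rewrite ler_wpM2l.
rewrite AE.
have -> : p%:R * K * (2 * r * l / (n p)%:R * s%:R) = (2 * r * K) * (p%:R * l * s%:R) / (n p)%:R :> R by ring.
rewrite ler_pdivrMr//.
apply: (@le_trans _ _ (2 * r * K * (p%:R `^ (3 / 2) / g))).
  by rewrite ler_wpM2l// !mulr_ge0// ltW.
have : 4 * r * K / g <= (n p)%:R / p%:R `^ (3 / 2) by lra.
rewrite ler_pdivlMr// => H.
have -> : 2 * r * K * (p%:R `^ (3 / 2) / g) = 2^-1 * (4 * r * K / g * p%:R `^ (3 / 2)) :> R by field; rewrite gt_eqF.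
by rewrite ler_pM2l.
Unshelve. all: by end_near. Qed.

End design.

Lemma limn_einf_ge_near {R : realType} (u : (\bar R)^nat) (c : \bar R) :
  (\forall n \near \oo, (c <= u n)%E) -> (c <= limn_einf u)%E.
Proof.
move=> [N _ uN]; rewrite limn_einf_lim; apply: lime_ge; first exact: is_cvg_einfs.
exists N => // m /= Nm; apply: le_ereal_inf_tmp => _ [k /= mk <-].
by apply: uN => /=; exact: leq_trans mk.
Qed.

Lemma eln_ge {R : realType} (x : R) (y : \bar R) : ((expR x)%:E <= y)%E -> (x%:E <= eln y)%E.
Proof.
case: y => [y| |] //; rewrite ?leey// lee_fin => xy.
have y0 : 0 < y by exact: lt_le_trans (expR_gt0 x) xy.
rewrite /eln (lt_geF y0) lee_fin -[x]expRK ler_ln// posrE expR_gt0//.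
Qed.

Theorem mainTheorem10 (R : realType) (alpha r sigma2 : R)
  (halpha : 1 / 2 < alpha < 1) (hr : alpha < r)
  (n : nat -> nat) (hn : (fun p => (n p)%:R : R) @ \oo --> +oo)
  (d : nat -> measure_display) (Om : forall p : nat, measurableType (d p))
  (P : forall p : nat, probability (Om p) R)
  (X : forall p : nat, Om p -> 'M[R]_(n p, p))
  (eps : forall p : nat, Om p -> 'cV[R]_(n p))
  (hnoise : forall p, std_gauss_vec (P p) (eps p))
  (hindep : forall p, indep_design_noise (P p) (X p) (eps p))
  (hdesign :
     ((forall p, SubG (P p) sigma2 (X p)) /\
      (fun p => (n p)%:R / (p%:R `^ (3 / 2)) : R) @ \oo --> +oo)
     \/
     ((forall p, Orthdesign (X p)) /\ (forall p, (p <= n p)%N))) :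
  let s := fun p : nat => Num.truncn ((p%:R : R) `^ (1 - alpha)) in
  let A := fun p : nat => Num.sqrt (2 * r * ln (p%:R : R) / (n p)%:R) in
  let tau := fun p : nat => Num.sqrt (2 * ln (p%:R : R)) in
  let infRisk := fun p : nat =>
    ereal_inf [set Risk (P p) (X p) (eps p) (xi_test t (tau p)) (s p) (A p)
              | t in [set: R]] in
  ((- ((r - alpha) ^+ 2 / (4 * r)))%:E <
   limn_einf (fun p => eln (infRisk p) * (((s p)%:R * ln (p%:R : R))^-1)%:E))%E.
Proof.
pose s (p : nat) := Num.truncn ((p%:R : R) `^ (1 - alpha)).
pose A (p : nat) := Num.sqrt (2 * r * ln (p%:R : R) / (n p)%:R).
pose tau (p : nat) := Num.sqrt (2 * ln (p%:R : R)).
pose infRisk (p : nat) :=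
  ereal_inf [set Risk (P p) (X p) (eps p) (xi_test t (tau p)) (s p) (A p) | t in [set: R]].
change ((- ((r - alpha) ^+ 2 / (4 * r)))%:E <
  limn_einf (fun p => eln (infRisk p) * (((s p)%:R * ln (p%:R : R))^-1)%:E))%E.
have /andP[a1 a2] := halpha.
have r0 : 0 < r by lra.
pose v : R := Num.max (Num.sqrt r) 1.
have [kappa [k01 kE vE]] := threshold_exists alpha r halpha hr.
have a01 : 0 < 1 - alpha <= 1 by apply/andP; split; lra.
have [c cE Hc] := exponents_near (1 - alpha) v kappa (- ln (normal_peak 1)) _ a01 k01 kE vE.
(* Strictness is carried by the gap between [c] and [(r - alpha) ^+ 2 / (4 * r)]; what remains is a
   bound by [- c] for all large [p]. *)
apply: (@lt_le_trans _ _ (- c)%:E); first by rewrite lte_fin ltrN2.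
have Hreg : \forall p \near \oo, (s p <= p)%N -> (0 < s p)%N -> 0 < A p ->
    regular_design (P p) (n p) p (s p) (X p) (A p).
  have K0 : 0 < 48 * expR (sigma2 / 2) :> R by rewrite mulr_gt0 ?expR_gt0.
  case: hdesign => [[HS hn2]|[HO pn]].
    have := design_size_near alpha r _ n halpha r0 K0 hn2.
    apply: filterS => p [pn small] sp s0 A0.
    apply: (regular_subG_design _ _ _ _ sigma2) => //; last exact/andP.
    by rewrite (leq_trans s0 sp).
  apply: nearW => p sp s0 A0.
  by apply: regular_orthdesign => //; rewrite (leq_trans s0 sp) pn.
have hn0 : \forall p \near \oo, 0 < (n p)%:R :> R by move/cvgryPgt : hn; exact.
have Htau := sqrt_ln_near _ Hc.
apply: limn_einf_ge_near; near=> p.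
have l1 : 1 <= ln p%:R :> R by near: p; exact: ln_natr_near.
have l0 : 0 < ln p%:R :> R by exact: lt_le_trans l1.
have p0 : (0 < p)%N.
  by rewrite lt0n; apply: contraTneq l1 => ->; rewrite ln0// -ltNge ltr01.
have tauE : tau p ^+ 2 = 2 * ln (p%:R : R) by rewrite sqr_sqrtr// mulr_ge0//; lra.
have [] : let k := (Num.truncn (kappa * (s p)%:R)).+1 in
    [/\ 4 <= tau p, (0 < s p)%N, (k <= s p)%N,
      k%:R * (ln k%:R + - ln (normal_peak 1) + 2 * tau p + 2) + 4 * expR (tau p)
        <= c * ((s p)%:R * ln p%:R) &
      ln 2 + (s p - k)%:R * (- ln (normal_peak 1) + ((v - 1) * tau p + 2) ^+ 2 / 2) +
        4 * expR (tau p) <= c * ((s p)%:R * ln p%:R)].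
  have H : forall q s0 : nat, tau p ^+ 2 = 2 * ln (q%:R : R) -> (0 < q)%N ->
     s0 = Num.truncn ((q%:R : R) `^ (1 - alpha)) ->
    let k := (Num.truncn (kappa * s0%:R)).+1 in
    [/\ 4 <= tau p, (0 < s0)%N, (k <= s0)%N,
      k%:R * (ln k%:R + - ln (normal_peak 1) + 2 * tau p + 2) + 4 * expR (tau p)
        <= c * (s0%:R * ln q%:R) &
      ln 2 + (s0 - k)%:R * (- ln (normal_peak 1) + ((v - 1) * tau p + 2) ^+ 2 / 2) +
        4 * expR (tau p) <= c * (s0%:R * ln q%:R)].
    by near: p; exact: Htau.
  exact: (H p (s p) tauE p0 erefl).
set k := (Num.truncn _).+1 => t4 s0 ks nullE altE.
have p1R : 1 <= p%:R :> R by rewrite ler1n.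
have sp : (s p <= p)%N.
  rewrite -(@ler_nat R); apply: (@le_trans _ _ ((p%:R : R) `^ (1 - alpha))).
    by have /andP[] := truncn_itv (powR_ge0 (p%:R : R) (1 - alpha)).
  by rewrite -[leRHS]powRr1 ?ler_powR//; lra.
have n0 : 0 < (n p)%:R :> R by near: p; exact: hn0.
have A0 : 0 < A p by rewrite sqrtr_gt0 divr_gt0// !mulr_gt0//; lra.
have [mX /andP[_ pn] pdX good] : regular_design (P p) (n p) p (s p) (X p) (A p).
  by move: sp s0 A0; near: p; exact: Hreg.
(* Relative to the threshold, the mean of a signal is [sqrt r], hence at most [v]. *)
have mA : Num.sqrt (n p)%:R * A p = Num.sqrt r * tau p.
  rewrite -!sqrtrM ?ltW// /A; last 1 first.
  congr Num.sqrt; field; rewrite gt_eqF//.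
have tau0 : 0 <= tau p by exact: sqrtr_ge0.
have v1 : 1 <= v by rewrite /v le_max lexx orbT.
have mAv : 0 <= Num.sqrt (n p)%:R * A p <= v * tau p.
  by rewrite mA mulr_ge0 ?sqrtr_ge0//= ler_wpM2r// /v le_max lexx.
have [x xB altE2] := alternative_exponent p (tau p) tauE p0 t4 v (Num.sqrt (n p)%:R * A p) k (s p)
   _ v1 mAv ks sp good.
have sl0 : 0 < (s p)%:R * ln p%:R :> R by rewrite mulr_gt0 ?ltr0n.
have infE : ((expR (- (c * ((s p)%:R * ln p%:R))))%:E <= infRisk p)%E.
  apply: le_ereal_inf_tmp => _ [t _ <-].
  apply: (Risk_ge _ _ _ _ _ _ _ _ _ _ _ (Xi_col_prefix p (s p) (A p) sp A0)).
  (* [k] does not depend on [t], and both cases give the same bound, which therefore passes to the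
     infimum over [t]. *)
  have [tk|kt] := ltP t k%:R; [left|right].
    apply: le_trans (null_rejection_lb (P p) (n p) p (X p) (eps p) mX pn (hnoise p) (hindep p) pdX t (tau p) k tk (leq_trans ks sp)).
    rewrite lee_fin; apply: le_trans (null_exponent p (tau p) tauE p0 t4 k _ (leq_trans ks sp)) => //.
    by rewrite ler_expR lerN2.
  apply: le_trans (alternative_acceptance_lb (P p) (n p) p (X p) (eps p) mX pn (hnoise p) (hindep p) pdX t (tau p) x (Num.sqrt (n p)%:R) (A p) k (s p) _ ks sp kt xB).
    rewrite lee_fin; apply: le_trans altE2.
    by rewrite ler_expR lerN2.
  by rewrite sqrtr_gt0.
have := eln_ge _ _ infE.
rewrite -(@lee_pmul2r _ (((s p)%:R * ln p%:R)^-1)%:E)//; last by rewrite lte_fin invr_gt0.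
apply: le_trans; rewrite -EFinM lee_fin mulNr mulfK// gt_eqF//.
Unshelve. all: by end_near. Qed.
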